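(* Let $T>0$, let $\psi$ be a positive function on $\mathbb{R}^n\times\mathbb{R}^+$, let $w$ be a weight on $\mathbb{R}^n$, and let $1\le p_0<\infty$, $1\le p<\infty$, with $1\le s<p$ if $1<p<\infty$ and $s=1$ if $p=1$. Let $w_1,w_2$ be weights with $(w_1^s,w_2^s)\in A_{p/s}$ and $w_2^s\in A_{p/s}$. Let $S$ be a sublinear operator satisfying, with a constant $C$ independent of $f$, $a$, $r$, $$\sup_{x\in B(a,r)}\left|S\left(f\cdot\mathcal{X}_{B(a,2r)^c}\right)(x)\right|\le C\sum_{k=1}^\infty(2^{k+1}r)^{-\frac ns}\left(\int_{B(a,2^{k+1}r)}|f(y)|^s\,dy\right)^{1/s},\quad (a,r)\in\mathbb{R}^n\times\mathbb{R}^+ .$$ Suppose that two positive functions $\psi_1,\psi_2$ on $\mathbb{R}^n\times\mathbb{R}^+$ satisfy $$\sup_{(a,r)\in\mathbb{R}^n\times\mathbb{R}^+}\frac1{\psi_2(a,r)}\int_r^\infty\frac{\inf_{t\le l<\infty}\psi_1(a,l)\,w_1(B(a,l))^{1/p}}{w_2(B(a,t))^{1/p}}\frac{dt}t<\infty .$$ Then: (i) if $1<p<\infty$ and $S$ is bounded from $L^{p,w_1}$ to $L^{p,w_2}$, then $S$ is bounded from $\mathcal{M}_\psi^{p_0,w}(0,T,\mathcal{M}^{p,w_1}_{\psi_1})$ to $\mathcal{M}_\psi^{p_0,w}(0,T,\mathcal{M}^{p,w_2}_{\psi_2})$; (ii) if $p=1$ and $S$ is bounded from $L^{1,w_1}$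 to $WL^{1,w_2}$, then $S$ is bounded from $\mathcal{M}_\psi^{p_0,w}(0,T,\mathcal{M}^{1,w_1}_{\psi_1})$ to $\mathcal{M}_\psi^{p_0,w}(0,T,W\mathcal{M}^{1,w_2}_{\psi_2})$.
   Context: Notation: $\mathbb{R}^+=(0,\infty)$; $B(a,r)$ is the open ball in $\mathbb{R}^n$; $\mathcal{X}_E$ is the indicator function of $E$ and $E^c$ its complement. A weight is a nonnegative locally integrable function on $\mathbb{R}^n$ with values in $(0,\infty)$ a.e.; $w(E)=\int_E w(x)\,dx$. Weight classes: for $1<p<\infty$, $(w_1,w_2)\in A_p$ if there is $C>0$ with $\left(\frac1{|B|}\int_B w_2\right)\left(\frac1{|B|}\int_B w_1^{-1/(p-1)}\right)^{p-1}\le C$ for all balls $B$; $(w_1,w_2)\in A_1$ if $\left(\frac1{|B|}\int_B w_2\right)\|w_1^{-1}\|_{L^\infty(B)}\le C$ for all balls $B$; $w\in A_p$ means $(w,w)\in A_p$. Spaces: $\|f\|_{L^{p,w}(E)}=\left(\int_E|f|^pw\right)^{1/p}$ and $\|f\|_{WL^{p,w}(E)}=\sup_{\gamma>0}\gamma\,w(\{x\in E:|f(x)|>\gamma\})^{1/p}$; $L^{p,w}$, $WL^{p,w}$ denote the case $E=\mathbb{R}^n$. For positive $\psi$ on $\mathbb{R}^n\times\mathbb{R}^+$, $\mathcal{M}^{p,w}_\psi$ and $W\mathcal{M}^{p,w}_\psi$ consist of the measurable $f$ for which respectively $\|f\|_{\mathcal{M}^{p,w}_\psi}=\sup_{a,r}\frac{1}{\psi(a,r)}w(B(a,r))^{-1/p}\|f\|_{L^{p,w}(B(a,r))}$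 and $\|f\|_{W\mathcal{M}^{p,w}_\psi}=\sup_{a,r}\frac{1}{\psi(a,r)}w(B(a,r))^{-1/p}\|f\|_{WL^{p,w}(B(a,r))}$ is finite. For $X$ one of these spaces, $\mathcal{M}^{p_0,w}_\psi(0,T,X)$ is the set of functions $f$ on $\mathbb{R}^n\times(0,T)$ with $$\|f\|_{\mathcal{M}^{p_0,w}_\psi(0,T,X)}=\sup_{a\in\mathbb{R}^n,\,r>0,\,t_0\in(0,T)}\frac1{\psi(a,r)}\frac1{w(B(a,r))^{1/p_0}}\left(\int_{(0,T)\cap(t_0-r,t_0+r)}\|f(\cdot,t)\|_X^{p_0}\,dt\right)^{1/p_0}<\infty .$$ The operator acts on functions of $(x,t)$ by acting on $f(\cdot,t)$ for each $t$. An operator $N$ is bounded from $X$ to $Y$ if there is $C>0$ with $\|Nf\|_Y\le C\|f\|_X$ for all $f\in X$. *)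

(* Defs.v *)
From HB Require Import structures.
From mathcomp Require Import all_boot all_order all_algebra.
From mathcomp Require Import all_classical all_reals all_analysis.

Set Implicit Arguments.
Unset Strict Implicit.
Unset Printing Implicit Defensive.

Import Order.TTheory GRing.Theory Num.Theory.
Import numFieldNormedType.Exports.

Local Open Scope classical_set_scope.
Local Open Scope ring_scope.
Local Open Scope ereal_scope.

(* Throughout, the Euclidean space of dimension n >= 1 is 'rV[R]_m.+1, with
   n = m.+1. The library has no n-dimensional Lebesgue measure: it is built here
   by the Caratheodory construction, from the outer measure given by countable
   covers by half-open boxes. *)
Section lebesgue_outer_measure.
Context {R : realType} {m : nat}.
Local Notation V := 'rV[R]_m.+1.

Definition box (c : V * V) : set V :=
  [set x | forall i, (c.1 ord0 i < x ord0 i <= c.2 ord0 i)%R].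

(* The maximum with 0 gives volume 0 to the boxes with c.2 ord0 i <= c.1 ord0 i
   for some i, which are empty. *)
Definition box_vol (c : V * V) : R :=
  (\prod_i Num.max 0 (c.2 ord0 i - c.1 ord0 i))%R.

Definition box_cover (A : set V) : set (nat -> V * V) :=
  [set Q | A `<=` \bigcup_k box (Q k)].

Definition lebesgue_outer (A : set V) : \bar R :=
  ereal_inf [set \sum_(0 <= k <oo) (box_vol (Q k))%:E | Q in box_cover A].

Lemma box_vol_ge0 c : (0 <= box_vol c)%R.
Proof. by apply: prodr_ge0 => i _; rewrite le_max lexx. Qed.

Lemma lebesgue_outer_ge0 A : 0 <= lebesgue_outer A.
Proof.
apply: le_ereal_inf_tmp => _ [Q _ <-].
by apply: nneseries_ge0 => k _ _; rewrite lee_fin box_vol_ge0.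
Qed.

Lemma le_lebesgue_outer :
  {homo lebesgue_outer : A B / A `<=` B >-> A <= B}.
Proof.
move=> A B AB; apply: ereal_inf_le_tmp => _ [Q QB <-].
by exists Q => //; exact: subset_trans QB.
Qed.

Lemma lebesgue_outer0 : lebesgue_outer set0 = 0.
Proof.
apply/eqP; rewrite eq_le lebesgue_outer_ge0 andbT.
apply: ereal_inf_lbound; exists (fun=> (0%R, 0%R)) => //.
apply: eseries0 => k _ _; rewrite /box_vol big_ord_recl /= mxE subrr maxxx.
by rewrite mul0r.
Qed.

Lemma lebesgue_outer_sigma_subadditive : sigma_subadditive lebesgue_outer.
Proof.
move=> A; have [[i ioo]|] := pselect (exists i, lebesgue_outer (A i) = +oo).
  rewrite (eseries_pinfty _ _ ioo) ?leey// => n _.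
  by rewrite -ltNye (lt_le_trans _ (lebesgue_outer_ge0 _)).
rewrite -forallNE => Aoo.
suff add2e (e : {posnum R}) :
    lebesgue_outer (\bigcup_n A n)
      <= \sum_(i <oo) lebesgue_outer (A i) + e%:num%:E.
  by apply/lee_addgt0Pr => _/posnumP[].
rewrite (le_trans _ (epsilon_trick _ _ _))//; last first.
  by move=> n; exact: lebesgue_outer_ge0.
pose P n (Q : nat -> V * V) := box_cover (A n) Q /\
  \sum_(k <oo) (box_vol (Q k))%:E
    <= lebesgue_outer (A n) + (e%:num / (2 ^ n.+1)%:R)%:E.
have [G PG] : {G : nat -> nat -> V * V & forall n, P n (G n)}.
  apply: (@choice _ _ P) => n; rewrite /P.
  have en1 : (0 < e%:num / (2 ^ n.+1)%:R :> R)%R by [].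
  have fn : lebesgue_outer (A n) \is a fin_num.
    by rewrite ge0_fin_numE ?lebesgue_outer_ge0// ltey; apply/eqP; exact: Aoo.
  have [_ [Q QA <-] /ltW ?] := lb_ereal_inf_adherent en1 fn.
  by exists Q.
pose v (ij : nat * nat) : \bar R := (box_vol (uncurry G ij))%:E.
have v0 ij : 0 <= v ij by rewrite lee_fin box_vol_ge0.
apply: (@le_trans _ _ (\esum_(ij in setT) v ij)).
  apply: ereal_inf_lbound => /=.
  have /card_esym/ppcard_eqP[f] := card_nat2.
  exists (uncurry G \o f).
    move=> t [i _ At]; have [j _ Gt] := (PG i).1 _ At.
    by exists (f^-1%FUN (i, j)) => //=; rewrite invK ?inE.
  rewrite -(esum_pred_image v _ xpredT) ?[fun=> _]set_true//.
  by rewrite image_eq.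
rewrite (_ : esum _ _ = \sum_(i <oo) \sum_(j <oo) v (i, j)); last first.
  pose J : nat -> set (nat * nat) := fun i => [set (i, j) | j in setT].
  rewrite (_ : setT = \bigcup_k J k); last first.
    by rewrite predeqE => -[a b]; split => // _; exists a => //; exists b.
  rewrite esum_bigcupT //=; last first.
    apply/trivIsetP => i j _ _ ij.
    rewrite predeqE => -[n k] /=; split => //= -[] [_] _ [<-{n} _].
    by move=> [k' _] [] /esym/eqP; rewrite (negbTE ij).
  rewrite -(image_id [set: nat]) -fun_true esum_pred_image//; last first.
    by move=> n _; exact: esum_ge0.
  apply: eq_eseriesr => /= j _.
  rewrite -(esum_pred_image v (pair j) predT)//=; last first.
    by move=> ? ? _ _; exact: (@can_inj _ _ _ snd).
  by congr esum; rewrite predeqE => -[a b]; split; move=> [i _ <-]; exists i.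
apply: lee_nneseries => [i _ _|i _]; last exact: (PG i).2.
exact: nneseries_ge0.
Qed.

HB.instance Definition _ := isOuterMeasure.Build R V lebesgue_outer
  lebesgue_outer0 lebesgue_outer_ge0 le_lebesgue_outer
  lebesgue_outer_sigma_subadditive.

End lebesgue_outer_measure.

(* R^(m.+1) with the sigma-algebra of Lebesgue (i.e. Caratheodory) measurable
   sets. *)
Notation Rn R m := (caratheodory_type (@lebesgue_outer R m)).

Definition leb {R : realType} {m : nat} : set (Rn R m) -> \bar R :=
  @lebesgue_outer R m.

HB.instance Definition _ (R : realType) (m : nat) :=
  let mu : {outer_measure set 'rV[R]_m.+1 -> \bar R} := @lebesgue_outer R m in
  isMeasure.Build _ (Rn R m) R (@leb R m)
    (@caratheodory_measure0 _ _ mu) (@caratheodory_measure_ge0 _ _ mu)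
    (@caratheodory_measure_sigma_additive _ _ mu).

Section weights_and_spaces.
Context {R : realType} {m : nat}.
Local Notation V := (Rn R m).

(* Open Euclidean ball; the library's ball on 'rV[R]_m.+1 is that of the
   sup-norm. *)
Definition eball (a : V) (r : R) : set V :=
  [set x | (Num.sqrt (\sum_i ((x : 'rV[R]_m.+1) ord0 i
                            - (a : 'rV[R]_m.+1) ord0 i) ^+ 2) < r)%R].

Definition weight (w : V -> R) : Prop :=
  [/\ measurable_fun setT w,
      forall x, (0 <= w x)%R,
      {ae leb, forall x, (0 < w x)%R}
    & forall K : set 'rV[R]_m.+1, compact K ->
        \int[leb]_(x in (K : set V)) (w x)%:E < +oo].

Definition wmeas (w : V -> R) (E : set V) : \bar R :=
  \int[leb]_(x in E) (w x)%:E.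

Definition average (B : set V) (g : V -> R) : \bar R :=
  (\int[leb]_(x in B) (g x)%:E) / leb B.

Definition Linfty_norm (B : set V) (g : V -> R) : \bar R :=
  'N[leb]_+oo[EFin \o (g \_ B)].

Definition Ap_factor (q : R) (B : set V) (w : V -> R) : \bar R :=
  if q == 1%R then Linfty_norm B (fun x => (w x)^-1)%R
  else average B (fun x => w x `^ (- (q - 1)^-1))%R `^ (q - 1).

(* (w1, w2) \in A_q, for 1 <= q *)
Definition Ap_class (q : R) (w1 w2 : V -> R) : Prop :=
  exists C : R, forall (a : V) (r : R), (0 < r)%R ->
    average (eball a r) w2 * Ap_factor q (eball a r) w1 <= C%:E.

Definition Lp_norm (p : R) (w : V -> R) (E : set V) (f : V -> R) : \bar R :=
  (\int[leb]_(x in E) (`|f x| `^ p * w x)%:E) `^ p^-1.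

Definition weak_Lp_norm (p : R) (w : V -> R) (E : set V) (f : V -> R) :
    \bar R :=
  ereal_sup [set gam%:E * wmeas w [set x | E x /\ (gam < `|f x|)%R] `^ p^-1
            | gam in [set gam : R | (0 < gam)%R]].

Definition positive_on (psi : V -> R -> R) : Prop :=
  forall a r, (0 < r)%R -> (0 < psi a r)%R.

Definition morrey_norm (psi : V -> R -> R) (p : R) (w : V -> R)
    (f : V -> R) : \bar R :=
  ereal_sup [set ((psi (ar : V * R).1 ar.2)^-1)%:E
                 * (wmeas w (eball ar.1 ar.2) `^ p^-1)^-1
                 * Lp_norm p w (eball ar.1 ar.2) f
            | ar in [set ar | (0 < ar.2)%R]].

Definition weak_morrey_norm (psi : V -> R -> R) (p : R) (w : V -> R)
    (f : V -> R) : \bar R :=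
  ereal_sup [set ((psi (ar : V * R).1 ar.2)^-1)%:E
                 * (wmeas w (eball ar.1 ar.2) `^ p^-1)^-1
                 * weak_Lp_norm p w (eball ar.1 ar.2) f
            | ar in [set ar | (0 < ar.2)%R]].

(* A space X of functions on R^n is given by its norm N: it consists of the
   measurable functions of finite norm. *)
Definition finite_norm_space (N : (V -> R) -> \bar R) : set (V -> R) :=
  [set f | measurable_fun setT f /\ N f < +oo].

Definition bounded_op (S : (V -> R) -> V -> R) (NX NY : (V -> R) -> \bar R) :
    Prop :=
  exists2 C : R, (0 < C)%R & forall f, finite_norm_space NX f ->
    finite_norm_space NY (S f) /\ NY (S f) <= C%:E * NX f.

Definition mixed_norm (psi : V -> R -> R) (p0 : R) (w : V -> R) (T : R)
    (N : (V -> R) -> \bar R) (f : V -> R -> R) : \bar R :=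
  ereal_sup [set ((psi (art : V * R * R).1.1 art.1.2)^-1)%:E
                 * (wmeas w (eball art.1.1 art.1.2) `^ p0^-1)^-1
                 * (\int[lebesgue_measure]_(t in `]0%R, T[ `&`
                      `](art.2 - art.1.2)%R, (art.2 + art.1.2)%R[)
                      (N (f ^~ t) `^ p0)) `^ p0^-1
            | art in [set art | (0 < art.1.2)%R /\ (0 < art.2 < T)%R]].

(* The values f x t for t outside ]0, T[ are irrelevant. The integral over t in
   mixed_norm only makes sense if f(., t) belongs to X for almost every t, as N
   is only meaningful on measurable functions. *)
Definition mixed_space (psi : V -> R -> R) (p0 : R) (w : V -> R) (T : R)
    (N : (V -> R) -> \bar R) : set (V -> R -> R) :=
  [set f | {ae lebesgue_measure, forall t : R,
             (0 < t < T)%R -> finite_norm_space N (f ^~ t)}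
           /\ mixed_norm psi p0 w T N f < +oo].

Definition act_slices (S : (V -> R) -> V -> R) (f : V -> R -> R) :
    V -> R -> R :=
  fun x t => S (f ^~ t) x.

Definition bounded_op_mixed (psi : V -> R -> R) (p0 : R) (w : V -> R) (T : R)
    (S : (V -> R) -> V -> R) (NX NY : (V -> R) -> \bar R) : Prop :=
  exists2 C : R, (0 < C)%R & forall f, mixed_space psi p0 w T NX f ->
    mixed_space psi p0 w T NY (act_slices S f) /\
    mixed_norm psi p0 w T NY (act_slices S f)
      <= C%:E * mixed_norm psi p0 w T NX f.

(* S is a sublinear operator defined on the vector space D of measurable
   functions; the values of S outside D are irrelevant. D is explicit because
   e.g. singular integrals are not defined on all measurable functions. *)
Record sublinear_op (D : set (V -> R)) (S : (V -> R) -> V -> R) : Prop := {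
  sublinear_dom_meas : forall f, D f -> measurable_fun setT f;
  sublinear_domD : forall f g, D f -> D g -> D (f \+ g)%R;
  sublinear_domZ : forall (c : R) f, D f -> D (fun x => c * f x)%R;
  sublinear_meas : forall f, D f -> measurable_fun setT (S f);
  sublinearD : forall f g, D f -> D g ->
    {ae leb, forall x, (`|S (f \+ g)%R x| <= `|S f x| + `|S g x|)%R};
  sublinearZ : forall (c : R) f, D f ->
    {ae leb, forall x, (`|S (fun y => c * f y) x| = `|c| * `|S f x|)%R} }.

Definition size_condition (s : R) (D : set (V -> R)) (S : (V -> R) -> V -> R) :
    Prop :=
  exists2 C : R, (0 < C)%R & forall (f : V -> R) (a : V) (r : R), (0 < r)%R ->
    let g : V -> R := fun x => (f x * \1_(~` eball a (2 * r)) x)%R in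
    D f -> D g ->
    ereal_sup [set (`|S g x|)%:E | x in eball a r]
    <= C%:E * \sum_(1 <= k <oo)
         (((2 ^+ k.+1 * r) `^ (- (m.+1%:R / s)))%R%:E
          * (\int[leb]_(y in eball a (2 ^+ k.+1 * r)%R)
               (`|f y| `^ s)%:E) `^ s^-1).

Definition psi_condition (p : R) (w1 w2 : V -> R) (psi1 psi2 : V -> R -> R) :
    Prop :=
  ereal_sup [set ((psi2 (ar : V * R).1 ar.2)^-1)%:E
    * \int[lebesgue_measure]_(t in `]ar.2, +oo[)
        (ereal_inf [set (psi1 ar.1 l)%:E * wmeas w1 (eball ar.1 l) `^ p^-1
                   | l in `[t, +oo[]
         / (wmeas w2 (eball ar.1 t) `^ p^-1)
         * (t^-1)%:E)
    | ar in [set ar | (0 < ar.2)%R]] < +oo.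

End weights_and_spaces.

(* Main.v *)
Require Import Defs.
From mathcomp Require Import all_boot all_order all_algebra.
From mathcomp Require Import all_classical all_reals all_analysis.
From mathcomp Require Import measurable_realfun ess_sup_inf.
From mathcomp Require Import ring lra.

Import Order.TTheory GRing.Theory Num.Theory.
Import numFieldNormedType.Exports.

Set Implicit Arguments.
Unset Strict Implicit.
Unset Printing Implicit Defensive.

Local Open Scope classical_set_scope.
Local Open Scope ring_scope.
Local Open Scope ereal_scope.

(** Boundedness on the Morrey spaces over R^n comes from one local estimate,
    sublinear_local_estimate. On a ball B = B(a,r), split f as f1 + f2 with f1
    the restriction of f to B(a,2r); up to a null set, |S f| is at most
    |S f1| + |S f2|. The boundedness of S on the whole space controls S f1 by
    the weighted norm of f on B(a,2r). The size condition bounds S f2 on B by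
    one number, a sum over k of averages of |f|^s over B(a,2^(k+1) r). With
    q = p/s, Hoelder's inequality and (w1,w2) in A_q turn each average into
    L_k / W_k, where L_k is the weighted norm of f on the ball of radius 2^k r
    and W_k = w2(B(a,2^k r))^(1/p). Since w2 is doubling, by w2 in A_q, the
    contribution of f1 has the same form, so that

      |S f|_B <= K W_0 sum_k L_k / W_k.

    If f has Morrey norm M, then L_k is at most M Phi(2^k r), where Phi(t) is
    the infimum over l >= t in the condition on psi1 and psi2: a norm on a ball
    is at most the norm on every larger concentric ball. As Phi is monotone and
    w2 doubling, sum_k Phi(2^k r) / W_k is at most a multiple of the integral
    in that condition (dyadic_sum_le_integral), hence of psi2(a,r)
    (bounded_on_morrey).

    The hypotheses concern w1^s and w2^s; Jensen's inequality gives the A_q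
    conditions for w1 and w2 themselves (Ap_class_of_powR). The strong and the
    weak case differ only in the norm measuring S f, and the argument uses
    only the properties of that norm collected in local_norm.

    The inequality just proved holds for almost every time slice, and
    integrating it in t gives the theorem (bounded_op_slices). The functions
    integrated in t need not be measurable; ae_le_integral_scale compares such
    integrals.

    The remaining work is about the Lebesgue measure on R^n, given as an outer
    measure by covers with boxes: balls are measurable, and the measures of
    concentric balls compare by dilating covers. *)

(** * Powers and integrals of nonnegative functions *)

Lemma ge0_le_poweR (R : realType) (e : R) (x y : \bar R) : (0 <= e)%R ->
  0 <= x -> x <= y -> x `^ e <= y `^ e.
Proof.
move=> e0 x0 xy; apply: gt0_ler_poweR => //; rewrite in_itv/= leey andbT//.
exact: le_trans xy.
Qed.

Section lower_integral.
Context d (T : measurableType d) (R : realType).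
Variable mu : {measure set T -> \bar R}.
Import HBNNSimple.

Lemma ae_imply (P Q : T -> Prop) : (forall x, P x -> Q x) ->
  {ae mu, forall x, P x} -> {ae mu, forall x, Q x}.
Proof. by move=> PQ; apply: filterS. Qed.

(** The integral of a nonnegative function is a supremum over the simple
    functions below it, and such integrals compare even for functions that are
    not measurable: a simple function below f, set to zero on the exceptional
    null set and divided by C, is a simple function below g. *)
Lemma ae_le_integral_scale (D : set T) (C : R) (f g : T -> \bar R) :
  (0 < C)%R -> (forall x, D x -> 0 <= f x) -> (forall x, D x -> 0 <= g x) ->
  {ae mu, forall x, D x -> f x <= C%:E * g x} ->
  \int[mu]_(x in D) f x <= C%:E * \int[mu]_(x in D) g x.
Proof.
move=> C0 f0 g0 [N [mN N0 fgN]].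
rewrite integral_mkcond [in leRHS]integral_mkcond.
rewrite !ge0_integralTE; [|exact: erestrict_ge0..].
apply: ge_ereal_sup => _ [h hf <-].
have mE (l : {nnsfun T >-> R}) : measurable_fun [set: T] (fun x => (l x)%:E).
  by apply/measurable_EFinP; exact: measurable_funPT.
have Ci0 : (0 <= C^-1)%R by rewrite invr_ge0 ltW.
pose k := scale_nnsfun (mul_nnsfun h (indic_nnsfun R (measurableC mN))) Ci0.
have kE x : k x = (C^-1 * (h x * \1_(~` N) x))%R by [].
have k0 x : (0 <= k x)%R by exact: fun_ge0.
have -> : sintegral mu h = C%:E * sintegral mu k.
  have kZ : C%:E * \int[mu]_x (k x)%:E = \int[mu]_x (C%:E * (k x)%:E).
    rewrite ge0_integralZl//; first by move=> x _; rewrite lee_fin.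
    by rewrite lee_fin ltW.
  rewrite -!integralT_nnsfun kZ; apply: ge0_ae_eq_integral => //.
  - by apply: measurable_funeM; exact: (mE k).
  - by move=> x _; rewrite lee_fin.
  - by move=> x _; apply: mule_ge0; rewrite lee_fin// ltW.
  exists N; split=> // x /not_implyP[_ hk].
  apply: contrapT => Nx; apply: hk.
  by rewrite -EFinM kE mulrA divff ?gt_eqF// mul1r indicE mem_set// mulr1.
rewrite lee_pmul2l//; apply: ereal_sup_ubound; exists k => // x.
rewrite kE indicE; have [xN|xN] := boolP (x \in ~` N); last first.
  by rewrite !mulr0; exact: erestrict_ge0.
rewrite mulr1; have {}xN : ~ N x by move/set_mem: xN.
have := hf x; rewrite !patchE; case: ifPn => [Dx hfx|_]; last first.
  rewrite lee_fin => h0; rewrite lee_fin; apply: mulr_ge0_le0 => //.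
have fgx : f x <= C%:E * g x.
  by apply: contrapT => fg; apply: xN; apply: fgN => /(_ (set_mem Dx)).
by rewrite EFinM muleC lee_pdivrMr// muleC (le_trans hfx).
Qed.

Lemma ae_le_integral (D : set T) (f g : T -> \bar R) :
  (forall x, D x -> 0 <= f x) -> (forall x, D x -> 0 <= g x) ->
  {ae mu, forall x, D x -> f x <= g x} ->
  \int[mu]_(x in D) f x <= \int[mu]_(x in D) g x.
Proof.
move=> f0 g0 fg; rewrite -[leRHS]mul1e; apply: ae_le_integral_scale => //.
by apply: filterS fg => x fgx /fgx; rewrite mul1e.
Qed.

Lemma le_integral_subset (A B : set T) (f g : T -> \bar R) :
  A `<=` B -> (forall x, B x -> 0 <= g x) ->
  (forall x, A x -> 0 <= f x <= g x) ->
  \int[mu]_(x in A) f x <= \int[mu]_(x in B) g x.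
Proof.
move=> AB g0 fg; rewrite integral_mkcond [leRHS]integral_mkcond.
have gB0 x : 0 <= (g \_ B) x by exact: erestrict_ge0.
apply: ae_le_integral => // [x _|].
  by apply: erestrict_ge0 => y /fg/andP[].
apply: nearW => x _; rewrite [leLHS]patchE; case: ifPn => // /set_mem Ax.
by rewrite patchE mem_set; [case/andP: (fg x Ax)|exact: AB].
Qed.

End lower_integral.
(** * Lebesgue measure of Euclidean balls *)

Section lebesgue_measure_of_balls.
Context {R : realType} {m : nat}.
Local Notation V := 'rV[R]_m.+1.
Local Notation n := m.+1.
Implicit Types (Q : V * V) (a : Rn R m) (r : R).

Let set_coord (v : V) (i : 'I_n) (x : R) : V :=
  \row_j (if j == i then x else v ord0 j).

Lemma box_vol_cut Q i (c : R) :
  box_vol Q =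
    (box_vol (Q.1, set_coord Q.2 i (Num.min (Q.2 ord0 i) c)) +
     box_vol (set_coord Q.1 i (Num.max (Q.1 ord0 i) c), Q.2))%R.
Proof.
have volE q : box_vol q = (Num.max 0 (q.2 ord0 i - q.1 ord0 i) *
    \prod_(j | j != i) Num.max 0 (q.2 ord0 j - q.1 ord0 j))%R.
  by rewrite /box_vol (bigD1 i).
rewrite !volE /= !mxE eqxx.
rewrite [X in (_ = _ * X + _)%R](eq_bigr
  (fun j => Num.max 0 (Q.2 ord0 j - Q.1 ord0 j))%R); last first.
  by move=> j /negPf ji; rewrite !mxE ji.
rewrite [X in (_ + _ * X)%R](eq_bigr
  (fun j => Num.max 0 (Q.2 ord0 j - Q.1 ord0 j))%R); last first.
  by move=> j /negPf ji; rewrite !mxE ji.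
rewrite -mulrDl; congr (_ * _)%R.
case: (leP (Q.2 ord0 i) c) => ?; case: (leP (Q.1 ord0 i) c) => ?;
  by do ![case: leP => ?]; lra.
Qed.

(** A hyperplane orthogonal to an axis cuts every box into two boxes of the
    same total volume; cutting a cover of X box by box thus gives covers of the
    two parts of X without increasing the sum of the volumes. *)
Lemma measurable_halfspace (i : 'I_n) (c : R) :
  measurable ([set x | ((x : V) ord0 i <= c)%R] : set (Rn R m)).
Proof.
apply: le_caratheodory_measurable => X.
apply: le_ereal_inf_tmp => _ [Q XQ <-].
pose Ql k := ((Q k).1, set_coord (Q k).2 i (Num.min ((Q k).2 ord0 i) c)).
pose Qr k := (set_coord (Q k).1 i (Num.max ((Q k).1 ord0 i) c), (Q k).2).
rewrite (eq_eseriesr (g := fun k => (box_vol (Ql k))%:E + (box_vol (Qr k))%:E));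
  last by move=> k _; rewrite -EFinD -box_vol_cut.
rewrite nneseriesD; [|by move=> k _ _; rewrite lee_fin box_vol_ge0..].
apply: leeD; apply: ereal_inf_lbound.
- exists Ql => // x [/XQ[k _ Qx] /= xc]; exists k => // j; have := Qx j.
  rewrite /= mxE; case: eqVneq => [->|_ //] /andP[-> ?] /=.
  by rewrite le_min xc andbT.
- exists Qr => // x [/XQ[k _ Qx] /= /negP]; rewrite -ltNge => xc.
  exists k => // j; have := Qx j.
  rewrite /= mxE; case: eqVneq => [->|_ //] /andP[? ->].
  by rewrite gt_max xc !andbT.
Qed.

Lemma measurable_coord (i : 'I_n) :
  measurable_fun [set: Rn R m] (fun x : Rn R m => (x : V) ord0 i).
Proof.
move=> mD; apply: (measurability _ (RGenOInfty.measurableE R)) => //.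
move=> /= _ [_ [c ->] <-]; rewrite setTI.
rewrite (_ : _ @^-1` _ = ~` [set x : Rn R m | ((x : V) ord0 i <= c)%R]).
  by apply: measurableC; exact: measurable_halfspace.
by apply/seteqP; split => x /=; rewrite in_itv/= andbT ltNge => /negP.
Qed.

Lemma measurable_eball a r : measurable (eball a r).
Proof.
pose d2 (x : Rn R m) := (\sum_i ((x : V) ord0 i - (a : V) ord0 i) ^+ 2)%R.
have -> : eball a r = (Num.sqrt \o d2) @^-1` `]-oo, r[.
  by apply/seteqP; split => x; rewrite /eball /= in_itv.
have mB : measurable (`]-oo, r[%classic : set R) by exact: measurable_itv.
have md2 : measurable_fun setT (Num.sqrt \o d2).
  apply: measurableT_comp.
    by apply: continuous_measurable_fun; exact: sqrt_continuous.
  apply: measurable_sum => i; apply: measurable_funX.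
  by apply: measurable_funB; [exact: measurable_coord|exact: measurable_cst].
by rewrite -[X in measurable X]setTI; exact: md2.
Qed.

Lemma subset_eball a (r1 r2 : R) : (r1 <= r2)%R -> eball a r1 `<=` eball a r2.
Proof. by move=> r12 x; rewrite /eball /= => /lt_le_trans; exact. Qed.

Lemma eball_coord a r (x : Rn R m) (i : 'I_n) : eball a r x ->
  (`|(x : V) ord0 i - (a : V) ord0 i| < r)%R.
Proof.
apply: le_lt_trans; rewrite -sqrtr_sqr ler_wsqrtr// (bigD1 i)//= lerDl.
by apply: sumr_ge0 => j _; exact: sqr_ge0.
Qed.

Lemma leb_eball_le a r : (0 <= r)%R ->
  leb (eball a r) <= ((2 * r) ^+ n)%:E.
Proof.
move=> r0; pose Q (k : nat) : V * V :=
  if k is 0%N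
  then (\row_i ((a : V) ord0 i - r)%R, \row_i ((a : V) ord0 i + r)%R)
  else (0%R, 0%R).
have v0 : box_vol (0%R, 0%R : V) = 0%R.
  by rewrite /box_vol big_ord_recl /= mxE subrr maxxx mul0r.
apply: (@le_trans _ _ (\sum_(0 <= k <oo) (box_vol (Q k))%:E)).
  apply: ereal_inf_lbound; exists Q => // x ax; exists 0%N => // i /=.
  rewrite !mxE; have := eball_coord i ax; rewrite ltr_norml => /andP[? ?].
  by apply/andP; split; lra.
rewrite nneseries_recl//; last by move=> k _; rewrite lee_fin box_vol_ge0.
rewrite [X in _ + X]eseries0 ?adde0 => [|[]//= k _ _]; last by rewrite v0.
rewrite lee_fin /box_vol /= (eq_bigr (fun=> 2 * r)%R) => [|i _].
  by rewrite prodr_const card_ord.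
by rewrite !mxE max_r; lra.
Qed.

(** Dilating about a by the factor c maps the covers of B(a,r) by boxes to
    covers of B(a,cr), and multiplies every volume by c^n. *)
Lemma leb_eball_dilate a r (c : R) : (0 < c)%R ->
  leb (eball a (c * r)) <= (c ^+ n)%:E * leb (eball a r).
Proof.
move=> c0; have cn0 : (0 < c ^+ n)%R by rewrite exprn_gt0.
rewrite muleC -lee_pdivrMr//; apply: le_ereal_inf_tmp => _ [Q BQ <-].
rewrite lee_pdivrMr// muleC -nneseriesZl//; last first.
  by move=> k _; rewrite lee_fin box_vol_ge0.
pose dil (v : V) : V :=
  \row_i ((a : V) ord0 i + c * (v ord0 i - (a : V) ord0 i))%R.
apply: ereal_inf_lbound; exists (fun k => (dil (Q k).1, dil (Q k).2)) => /=.
  move=> x ax.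
  pose y : V :=
    \row_i ((a : V) ord0 i + c^-1 * ((x : V) ord0 i - (a : V) ord0 i))%R.
  (* y is the point of B(a,r) that the dilation sends to x. *)
  have /BQ[k _ Qy] : eball a r y.
    rewrite /eball/= -(ltr_pM2l c0).
    have -> : (c * Num.sqrt (\sum_i (y ord0 i - (a : V) ord0 i) ^+ 2) =
        Num.sqrt (\sum_i ((x : V) ord0 i - (a : V) ord0 i) ^+ 2))%R.
      rewrite -[in LHS](gtr0_norm c0) -sqrtr_sqr -sqrtrM ?sqr_ge0//.
      congr Num.sqrt; rewrite mulr_sumr; apply: eq_bigr => i _.
      by rewrite mxE; field; rewrite gt_eqF.
    exact: ax.
  exists k => // i; have := Qy i; rewrite /= !mxE.
  rewrite -(ltr_pM2l c0) -[X in _ && X -> _](ler_pM2l c0) => /andP[].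
  rewrite mulrDr mulrA divff ?gt_eqF// mul1r => ? ?.
  by apply/andP; split; lra.
apply: eq_eseriesr => k _; rewrite -EFinM; congr EFin.
have -> : (c ^+ n = \prod_(i < n) c)%R by rewrite prodr_const card_ord.
rewrite /box_vol -big_split/=.
apply: eq_bigr => i _; rewrite !mxE maxr_pMr ?ltW// mulr0; congr Num.max.
by ring.
Qed.

Lemma leb_eball_lty a r : leb (eball a r) < +oo.
Proof.
apply: (@le_lt_trans _ _ (leb (eball a `|r|)%R)).
  by apply: le_lebesgue_outer; apply: subset_eball; exact: ler_norm.
by rewrite (le_lt_trans (leb_eball_le _ _))// ltry.
Qed.

Lemma leb_eball_fin a r : 0 < leb (eball a r) ->
  exists2 b : R, (0 < b)%R & leb (eball a r) = b%:E.
Proof.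
move=> B0; have Bf : leb (eball a r) \is a fin_num.
  by rewrite ge0_fin_numE ?leb_eball_lty// ltW.
by exists (fine (leb (eball a r))); rewrite ?fineK// -lte_fin fineK.
Qed.

End lebesgue_measure_of_balls.
(** * Hoelder's inequality with a weight *)

(** Hoelder's inequality for the product of g u^(1/q) and u^(-1/q), with the
    exponents q and q/(q-1), raised to the power q. *)
Lemma weighted_hoelder d (T : measurableType d) (R : realType)
    (mu : {measure set T -> \bar R}) (B : set T) (q : R) (g u : T -> R) :
  measurable B -> (1 < q)%R ->
  measurable_fun setT g -> measurable_fun setT u ->
  (forall x, 0 <= g x)%R -> (forall x, 0 <= u x)%R ->
  {ae mu, forall x, (0 < u x)%R} ->
  (\int[mu]_(x in B) (g x)%:E) `^ q <=
  (\int[mu]_(x in B) (g x `^ q * u x)%:E) *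
  (\int[mu]_(x in B) (u x `^ (- (q - 1)^-1))%:E) `^ (q - 1).
Proof.
move=> mB q1 mg mu_ g0 u0 upos.
have q0 : (0 < q)%R by lra.
have qn0 : q != 0%R by rewrite gt_eqF.
have q10 : (0 < q - 1)%R by lra.
have q1n0 : (q - 1 != 0)%R by rewrite gt_eqF.
pose q' := (q / (q - 1))%R.
have q'0 : (0 < q')%R by exact: divr_gt0.
pose f1 := ((fun x => g x * u x `^ q^-1) \_ B)%R.
pose f2 := ((fun x => u x `^ (- q^-1)) \_ B)%R.
have mpow e : measurable_fun setT (fun x => u x `^ e)%R.
  exact: (measurableT_comp (@measurable_powR R e) mu_).
have mf1 : measurable_fun setT f1.
  apply/(measurable_restrictT _ mB); apply: measurable_funTS.
  exact: measurable_funM.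
have mf2 : measurable_fun setT f2.
  by apply/(measurable_restrictT _ mB); apply: measurable_funTS.
have qq' : (q^-1 + q'^-1 = 1)%R by rewrite /q'; field; rewrite ?qn0 ?q1n0.
have := hoelder mu mf1 mf2 q0 q'0 qq'.
have f12E : 'N[mu]_1[EFin \o (f1 \* f2)%R] = \int[mu]_(x in B) (g x)%:E.
  rewrite Lnorm1 [RHS]integral_mkcond; apply: ge0_ae_eq_integral => //.
  - apply: measurableT_comp => //.
    by apply/measurable_EFinP; exact: measurable_funM.
  - apply/(measurable_restrictT _ mB); apply: measurable_funTS.
    exact/measurable_EFinP.
  - by move=> x _; apply: erestrict_ge0 => y _; rewrite lee_fin.
  apply: filterS upos => x ux _ /=.
  rewrite /f1 /f2 !patchE; case: ifPn => _; last by rewrite mulr0 normr0.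
  rewrite -mulrA -powRD ?subrr; last by rewrite (gt_eqF ux) implybT.
  by rewrite powRr0 mulr1 ger0_norm.
have f1E : 'N[mu]_q%:E[EFin \o f1] `^ q =
    \int[mu]_(x in B) (g x `^ q * u x)%:E.
  rewrite powR_Lnorm// [RHS]integral_mkcond; apply: eq_integral => x _ /=.
  rewrite /f1 !patchE; case: ifPn => _; last by rewrite normr0 powR0.
  rewrite ger0_norm ?mulr_ge0 ?powR_ge0// powRM ?powR_ge0// -powRrM mulVf//.
  by rewrite powRr1.
have f2E : 'N[mu]_q'%:E[EFin \o f2] `^ q =
    (\int[mu]_(x in B) (u x `^ (- (q - 1)^-1))%:E) `^ (q - 1).
  have -> : q = (q' * (q - 1))%R by rewrite /q'; field; rewrite ?qn0 ?q1n0.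
  rewrite poweRrM powR_Lnorm ?gt_eqF//; congr (_ `^ _).
    rewrite [RHS]integral_mkcond; apply: eq_integral => x _ /=.
    rewrite /f2 !patchE; case: ifPn => _; last by rewrite normr0 powR0 ?gt_eqF.
    rewrite ger0_norm ?powR_ge0// -powRrM; congr (_ `^ _)%:E.
    by rewrite /q'; field; rewrite ?qn0 ?q1n0.
  by rewrite /q'; field; rewrite ?qn0 ?q1n0.
rewrite f12E => /(gt0_ler_poweR (ltW q0)).
rewrite poweRM ?Lnorm_ge0// f1E f2E; apply; rewrite in_itv/= ?andbT leey ?andbT.
- by apply: integral_ge0 => x _; rewrite lee_fin.
- by rewrite mule_ge0// Lnorm_ge0.
Qed.

Lemma integral_powR_le d (T : measurableType d) (R : realType)
    (mu : {measure set T -> \bar R}) (B : set T) (s : R) (g : T -> R) :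
  measurable B -> (1 <= s)%R ->
  measurable_fun setT g -> (forall x, 0 <= g x)%R ->
  (\int[mu]_(x in B) (g x)%:E) `^ s <=
  (\int[mu]_(x in B) (g x `^ s)%:E) * mu B `^ (s - 1).
Proof.
move=> mB s1 mg g0.
have [->|sn1] := eqVneq s 1%R.
  rewrite subrr poweRe0 mule1 poweRe1; last first.
    by apply: integral_ge0 => x _; rewrite lee_fin.
  by under [leRHS]eq_integral do rewrite powRr1//.
have {}s1 : (1 < s)%R by rewrite lt_neqAle eq_sym sn1.
have := @weighted_hoelder _ _ _ mu B s g (fun=> 1%R) mB s1 mg.
rewrite powR1 integral_cst// mul1e.
under [X in _ -> _ -> _ -> _ -> _ <= X * _]eq_integral do rewrite mulr1.
by apply=> //; apply: nearW => x; exact: ltr01.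
Qed.
(** * Muckenhoupt classes *)

Section weighted_estimates.
Context {R : realType} {m : nat}.
Local Notation V := (Rn R m).
Local Notation n := m.+1.
Implicit Types (a : V) (r : R) (u v g : V -> R).

Lemma integral_eball0 a r g : measurable_fun setT g ->
  leb (eball a r) = 0 -> \int[leb]_(x in eball a r) (g x)%:E = 0.
Proof.
move=> mg B0; have mgE : measurable_fun (eball a r) (EFin \o g).
  by apply: measurable_funTS; exact/measurable_EFinP.
exact: (null_set_integral (measurable_eball a r) mgE B0).
Qed.

(** The two forms of the A_q factor play the same part: for q = 1 the bound of
    1/u by its essential supremum on the ball replaces Hoelder's inequality. *)
Lemma Ap_hoelder (q : R) u g a r : (1 <= q)%R -> weight u ->
  measurable_fun setT g -> (forall x, 0 <= g x)%R -> 0 < leb (eball a r) ->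
  (\int[leb]_(x in eball a r) (g x)%:E) `^ q <=
  (\int[leb]_(x in eball a r) (g x `^ q * u x)%:E) *
  (leb (eball a r) `^ (q - 1) * Ap_factor q (eball a r) u).
Proof.
move=> q1 [mu_ u0 upos _] mg g0 B0.
set B := eball a r in B0 *; have mB : measurable B by exact: measurable_eball.
rewrite /Ap_factor; case: eqVneq => [->|qn1].
  rewrite subrr poweRe0 mul1e poweRe1; last first.
    by apply: integral_ge0 => x _; rewrite lee_fin.
  have T0 : 0 < (leb : set V -> \bar R) setT.
    by rewrite (lt_le_trans B0)// le_measure ?inE.
  rewrite /Linfty_norm unlock /= T0.
  set L := ess_sup _ _.
  have aeL := ess_sup_ge leb (abse \o (EFin \o (fun x => (u x)^-1)%R \_ B)).
  have L0 : 0 <= L.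
    by apply: ess_sup_gee => //; apply: nearW => x; exact: abse_ge0.
  have mgu : measurable_fun B (fun x => (g x `^ 1 * u x)%:E).
    apply/measurable_funTS/measurable_EFinP; apply: measurable_funM.
      exact: (measurableT_comp (@measurable_powR R 1) mg).
    exact: mu_.
  have gu0 x : B x -> 0 <= (g x `^ 1 * u x)%:E.
    by move=> _; rewrite lee_fin mulr_ge0// powR_ge0.
  rewrite muleC -(ge0_integralZl leb mB mgu gu0 L0).
  apply: ae_le_integral.
  - by move=> x _; rewrite lee_fin.
  - by move=> x _; rewrite mule_ge0// lee_fin mulr_ge0// powR_ge0.
  move: upos aeL; apply: filterS2 => x ux.
  rewrite -/L /= patchE => + Bx; rewrite mem_set// => uL.
  rewrite powRr1//; have {1}-> : g x = ((g x * u x) * (u x)^-1)%R.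
    by rewrite -mulrA divff ?mulr1// gt_eqF.
  rewrite EFinM [leRHS]muleC lee_wpmul2l ?lee_fin ?mulr_ge0//.
  by apply: le_trans uL; rewrite lee_fin ler_norm.
have {}q1 : (1 < q)%R by rewrite lt_neqAle eq_sym qn1.
apply: (le_trans (weighted_hoelder mB q1 mg mu_ g0 u0 upos)).
apply: lee_wpmul2l.
  by apply: integral_ge0 => x _; rewrite lee_fin mulr_ge0// powR_ge0.
rewrite /average -poweRM; last 2 first.
- exact: ltW.
- rewrite mule_ge0 ?inve_ge0 ?(ltW B0)//.
  by apply: integral_ge0 => x _; rewrite lee_fin powR_ge0.
by rewrite muleCA divee ?mule1 ?gt_eqF// ge0_fin_numE ?leb_eball_lty// ltW.
Qed.

(** All consequences of the A_q condition go through this inequality. With g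
    the indicator function of a smaller ball it yields the doubling property,
    with g = |f|^s it bounds the averages of |f|^s. *)
Lemma Ap_ball_bound (q : R) u v : (1 <= q)%R -> weight u -> weight v ->
  Ap_class q u v -> exists2 C : R, (0 < C)%R &
  forall a r g, (0 < r)%R -> measurable_fun setT g -> (forall x, 0 <= g x)%R ->
    (\int[leb]_(x in eball a r) (g x)%:E) `^ q * wmeas v (eball a r) <=
    C%:E * (leb (eball a r) `^ q *
      \int[leb]_(x in eball a r) (g x `^ q * u x)%:E).
Proof.
move=> q1 wu [mv v0 _ _] [C0 hC].
(* Nothing is known about the sign of C0. *)
exists (Num.max C0 1%R); first by rewrite lt_max ltr01 orbT.
move=> a r g r0 mg g0; have := hC a r r0.
set B := eball a r; set I := \int[leb]_(x in B) _.
set G := \int[leb]_(x in B) _.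
have G0 : 0 <= G.
  case: wu => mu_ u0 _ _.
  by apply: integral_ge0 => x _; rewrite lee_fin mulr_ge0// powR_ge0.
have C1 : (0 <= Num.max C0 1)%R by rewrite le_max ler01 orbT.
have : 0 <= leb B by exact: lebesgue_outer_ge0.
rewrite le_eqVlt => /orP[/eqP/esym B0|B0].
  move=> _; rewrite /wmeas integral_eball0// mule0.
  by rewrite !mule_ge0// ?poweR_ge0.
rewrite /average -/(wmeas v B) => AC.
have leI := Ap_hoelder q1 wu mg g0 B0.
have v0B : 0 <= wmeas v B by apply: integral_ge0 => x _; rewrite lee_fin.
apply: (le_trans (lee_wpmul2r v0B leI)).
rewrite -/B -/G; set F := Ap_factor q B u in AC *.
have [b b0 bE] : exists2 b, (0 < b)%R & leb B = b%:E := leb_eball_fin B0.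
have {}AC : F * wmeas v B <= (Num.max C0 1%R)%:E * leb B.
  rewrite bE -lee_pdivrMr//; move: AC; rewrite bE inver gt_eqF// => AC.
  rewrite -muleA [leLHS]muleC (le_trans AC)// lee_fin.
  by rewrite le_max lexx.
have -> : leb B `^ q = leb B `^ (q - 1) * leb B.
  rewrite -[X in _ * X](poweRe1 (ltW B0)) -poweRD ?subrK//.
  by apply: nneg_neq0_poweRD_def; rewrite ?gt_eqF// subr_ge0.
set P := leb B `^ _; have P0 : 0 <= P by exact: poweR_ge0.
have -> : G * (P * F) * wmeas v B = G * P * (F * wmeas v B) by rewrite !muleA.
rewrite (le_trans (lee_wpmul2l _ AC)) ?mule_ge0//.
by rewrite muleCA -(muleA G) (muleC G).
Qed.

(** Jensen's inequality for the power s; on a null ball both sides are 0. *)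
Lemma average_powR_le (s : R) g a r : (1 <= s)%R ->
  measurable_fun setT g -> (forall x, 0 <= g x)%R ->
  average (eball a r) g `^ s <= average (eball a r) (fun x => g x `^ s)%R.
Proof.
move=> s1 mg g0; have s0 : (0 < s)%R by rewrite (lt_le_trans ltr01).
have mgs : measurable_fun setT (fun x => g x `^ s)%R.
  exact: (measurableT_comp (@measurable_powR R s) mg).
have : 0 <= leb (eball a r) by exact: lebesgue_outer_ge0.
rewrite /average le_eqVlt => /orP[/eqP/esym B0|B0].
  by rewrite !integral_eball0// !mul0e poweR0r ?gt_eqF.
set I := \int[_]_(_ in _) _; set J := \int[_]_(_ in _) _.
have : I `^ s <= J * leb (eball a r) `^ (s - 1).
  exact: (integral_powR_le leb (measurable_eball a r) s1 mg g0).
have I0 : 0 <= I by apply: integral_ge0 => x _; rewrite lee_fin.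
have [b b0 ->] := leb_eball_fin B0.
rewrite inver gt_eqF// poweRM//; last by rewrite lee_fin invr_ge0 ltW.
move=> IJ; have bs : 0 <= b^-1%:E `^ s by exact: poweR_ge0.
apply: (le_trans (lee_wpmul2r bs IJ)).
rewrite -muleA !poweR_EFin -EFinM.
suff -> : (b `^ (s - 1) * b^-1 `^ s)%R = b^-1%R by [].
rewrite -powR_inv1 ?ltW// -powRrM mulN1r -powRD; last first.
  by rewrite (gt_eqF b0) implybT.
by rewrite addrAC subrr add0r.
Qed.

(** By Jensen's inequality for each of its two factors, the s-th power of the
    A_q product for u and v is at most the A_q product for u^s and v^s. *)
Lemma Ap_class_of_powR (q s : R) u v : (1 < q)%R -> (1 <= s)%R ->
  weight u -> weight v ->
  Ap_class q (fun x => u x `^ s)%R (fun x => v x `^ s)%R -> Ap_class q u v.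
Proof.
move=> q1 s1 [mu_ u0 _ _] [mv v0 _ _] [C hC]; have s0 : (0 < s)%R by lra.
exists (`|C| `^ s^-1)%R => a r r0; have := hC a r r0.
rewrite /Ap_factor gt_eqF//.
set e := (- (q - 1)^-1)%R.
have -> : (fun x => ((u x `^ s) `^ e)%R) = (fun x => ((u x `^ e) `^ s)%R).
  by apply/funext => x; rewrite powRAC.
set X := average _ _; set Y := average _ _ => XYC.
set X1 := average _ _; set Y1 := average _ _.
have avg0 g : (forall x, 0 <= g x)%R -> 0 <= average (eball a r) g.
  move=> g0; rewrite mule_ge0 ?inve_ge0 ?lebesgue_outer_ge0//.
  by apply: integral_ge0 => x _; rewrite lee_fin.
have X10 : 0 <= X1 by exact: avg0.
have Y10 : 0 <= Y1 by apply: avg0 => x; exact: powR_ge0.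
have X0 : 0 <= X by apply: avg0 => x; exact: powR_ge0.
have Y0 : 0 <= Y by apply: avg0 => x; exact: powR_ge0.
have X1X : X1 `^ s <= X by exact: average_powR_le.
have Y1Y : Y1 `^ s <= Y.
  have mue : measurable_fun setT (fun x => u x `^ e)%R.
    exact: (measurableT_comp (@measurable_powR R e) mu_).
  by apply: (average_powR_le a r s1 mue) => x; exact: powR_ge0.
have XY0 : 0 <= X1 * Y1 `^ (q - 1) by rewrite mule_ge0// poweR_ge0.
rewrite -poweR_EFin -[leLHS]poweRe1//.
rewrite -[X in _ `^ X <= _](@divff _ s) ?gt_eqF// poweRrM.
apply: ge0_le_poweR; rewrite ?invr_ge0 ?(ltW s0) ?poweR_ge0//.
rewrite poweRM ?poweR_ge0// [_ `^ (q - 1) `^ s]poweRAC.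
apply: (@le_trans _ _ (X * Y `^ (q - 1))).
  apply: lee_pmul; [exact: poweR_ge0|exact: poweR_ge0|exact: X1X|].
  apply: ge0_le_poweR; [|exact: poweR_ge0|exact: Y1Y].
  by rewrite subr_ge0 ltW.
by apply: (le_trans XYC); rewrite lee_fin ler_norm.
Qed.

Lemma wmeas_ge0 v (E : set V) : weight v -> 0 <= wmeas v E.
Proof. by move=> [_ v0 _ _]; apply: integral_ge0 => x _; rewrite lee_fin. Qed.

Lemma le_wmeas v (E F : set V) : weight v -> E `<=` F -> wmeas v E <= wmeas v F.
Proof.
move=> [_ v0 _ _] EF.
by apply: le_integral_subset => // x _; rewrite ?lexx lee_fin v0.
Qed.

Lemma wmeas_eball_lty v a r : weight v -> wmeas v (eball a r) < +oo.
Proof.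
move=> wv; have [_ _ _ vK] := wv.
(* The ball lies in a closed cube, which is compact. *)
pose I (i : 'I_n) : set R :=
  [set` `[((a : 'rV[R]_n) ord0 i - r)%R, ((a : 'rV[R]_n) ord0 i + r)%R]].
have /vK : compact [set x : 'rV[R]_n | forall i, I i (x ord0 i)].
  by apply: rV_compact => i; exact: segment_compact.
apply: le_lt_trans; apply: le_wmeas => // x ax i.
have := eball_coord i ax; rewrite ltr_norml /I /= in_itv/= => /andP[? ?].
by apply/andP; split; lra.
Qed.

(** Apply Ap_ball_bound on B(a,2r) to the indicator function of B(a,r). *)
Lemma Ap_doubling (q : R) v : (1 <= q)%R -> weight v -> Ap_class q v v ->
  exists2 K : R, (0 < K)%R & forall a r, (0 < r)%R ->
    wmeas v (eball a (2 * r)) <= K%:E * wmeas v (eball a r).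
Proof.
move=> q1 wv Av; have q0 : (0 < q)%R by lra.
have [C C0 hC] := Ap_ball_bound q1 wv wv Av.
have t0 : (0 < (2 ^+ n : R) `^ q)%R by rewrite powR_gt0// exprn_gt0.
exists (C * (2 ^+ n) `^ q)%R; first exact: mulr_gt0.
move=> a r r0; set B := eball a r; set B2 := eball a (2 * r).
have BB2 : B `<=` B2 by apply: subset_eball; lra.
have mB : measurable B by exact: measurable_eball.
have [mv v0 _ _] := wv.
have leb2 : leb B2 <= (2 ^+ n)%:E * leb B by exact: leb_eball_dilate.
have : 0 <= leb B by exact: lebesgue_outer_ge0.
rewrite le_eqVlt => /orP[/eqP/esym B0|B0].
  have B20 : leb B2 = 0.
    apply/eqP; rewrite eq_le lebesgue_outer_ge0 andbT.
    by rewrite (le_trans leb2)// B0 mule0.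
  rewrite {1}/wmeas integral_eball0// mule_ge0 ?wmeas_ge0//.
  by rewrite lee_fin mulr_ge0// ltW.
have : leb B `^ q * wmeas v B2 <= C%:E * (leb B2 `^ q * wmeas v B).
  have -> : wmeas v B = \int[leb]_(x in B2) (\1_B x `^ q * v x)%:E.
    rewrite /wmeas [LHS]integral_mkcond [RHS]integral_mkcond.
    apply: eq_integral => x _; rewrite !patchE indicE.
    have [xB|xB] := boolP (x \in B); last first.
      by rewrite powR0 ?gt_eqF// mul0r if_same.
    by rewrite powR1 mul1r mem_set//; apply: BB2; exact: set_mem.
  have -> : leb B = \int[leb]_(x in B2) (\1_B x : R)%:E.
    rewrite integral_indic//; first by rewrite setIidl.
    exact: measurable_eball.
  apply: hC; first by rewrite mulr_gt0.
    exact: measurable_indic.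
  by move=> x; rewrite indicE.
have [b b0 bE] : exists2 b, (0 < b)%R & leb B = b%:E := leb_eball_fin B0.
have leb2q : leb B2 `^ q <= ((2 ^+ n : R) `^ q)%:E * (b `^ q)%:E.
  rewrite -!poweR_EFin -poweRM ?lee_fin ?exprn_ge0 ?(ltW b0)// -bE.
  by apply: ge0_le_poweR; rewrite ?(ltW q0) ?lebesgue_outer_ge0.
have bq : (0 < b `^ q)%R by exact: powR_gt0.
rewrite bE poweR_EFin => h; rewrite -(@lee_pmul2l _ (b `^ q)%:E)//.
apply: (le_trans h); rewrite EFinM -!muleA [leRHS]muleCA lee_pmul2l//.
rewrite [leRHS]muleCA [leRHS]muleA.
by apply: lee_wpmul2r; [exact: wmeas_ge0|exact: leb2q].
Qed.

(** * Weighted strong and weak norms *)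

Lemma le_Lp_norm (p : R) u (E F : set V) g : (0 < p)%R -> weight u ->
  E `<=` F -> Lp_norm p u E g <= Lp_norm p u F g.
Proof.
move=> p0 [_ u0 _ _] EF.
have gu x : 0 <= (`|g x| `^ p * u x)%:E by rewrite lee_fin mulr_ge0// powR_ge0.
apply: ge0_le_poweR; [by rewrite invr_ge0 ltW|exact: integral_ge0|].
by apply: le_integral_subset => // x _; rewrite gu lexx.
Qed.

Lemma Lp_norm0 (p : R) u (E : set V) g : (0 < p)%R -> weight u ->
  measurable E -> measurable_fun setT g -> wmeas u E = 0 -> Lp_norm p u E g = 0.
Proof.
move=> p0 [mu_ u0 _ _] mE mg uE0.
have uabs : \int[leb]_(x in E) `|(u x)%:E| = 0.
  by rewrite -[RHS]uE0; apply: eq_integral => x _; rewrite gee0_abs ?lee_fin.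
have aeu : ae_eq leb E (EFin \o u) (cst 0).
  apply/(ae_eq_integral_abs _ mE) => //.
  by apply: measurable_funTS; exact/measurable_EFinP.
rewrite /Lp_norm; suff -> : \int[leb]_(x in E) (`|g x| `^ p * u x)%:E = 0.
  by rewrite poweR0r// invr_eq0 gt_eqF.
apply/eqP; rewrite eq_le integral_ge0 ?andbT; last first.
  by move=> x _; rewrite lee_fin mulr_ge0// powR_ge0.
rewrite -(integral0 (leb : {measure set V -> \bar R}) E).
apply: ae_le_integral => // [x _|].
  by rewrite lee_fin mulr_ge0// powR_ge0.
apply: filterS aeu => x ux Ex; have [-> //] := ux Ex.
by rewrite mulr0.
Qed.

(** This converts a term of the size condition, an average of |g|^s, into the
    quotient of the weighted norm of g by v(B)^(1/p). It is stated without the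
    division, hence also for balls on which v vanishes. *)
Lemma Ap_Lp_bound (p s : R) u v : (1 <= s)%R -> (s <= p)%R ->
  weight u -> weight v -> Ap_class (p / s) u v ->
  exists2 K : R, (0 < K)%R & forall a r g, (0 < r)%R -> measurable_fun setT g ->
    (r `^ (- (n%:R / s)))%:E *
      (\int[leb]_(x in eball a r) (`|g x| `^ s)%:E) `^ s^-1 *
      wmeas v (eball a r) `^ p^-1
    <= K%:E * Lp_norm p u (eball a r) g.
Proof.
move=> s1 sp wu wv Auv.
have s0 : (0 < s)%R by lra.
have p0 : (0 < p)%R by lra.
have q1 : (1 <= p / s)%R by rewrite ler_pdivlMr// mul1r.
have [C C0 hC] := Ap_ball_bound q1 wu wv Auv.
have [_ u0 _ _] := wu.
pose K := (C `^ p^-1 * (2 ^+ n) `^ s^-1)%R.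
have K0 : (0 < K)%R by rewrite mulr_gt0// powR_gt0// exprn_gt0.
exists K => // a r g r0 mg; set B := eball a r.
have mgs : measurable_fun setT (fun x => `|g x| `^ s)%R.
  apply: (measurableT_comp (@measurable_powR R s)).
  exact: measurableT_comp.
have := hC a r _ r0 mgs (fun x => powR_ge0 _ _).
set I := \int[leb]_(x in B) _.
have -> : \int[leb]_(x in B) ((`|g x| `^ s) `^ (p / s) * u x)%:E =
          \int[leb]_(x in B) (`|g x| `^ p * u x)%:E.
  by apply: eq_integral => x _; rewrite -powRrM [(s * _)%R]mulrC divfK ?gt_eqF.
set J := \int[leb]_(x in B) _ => IJ.
have I0 : 0 <= I by apply: integral_ge0 => x _; rewrite lee_fin powR_ge0.
have J0 : 0 <= J.
  by apply: integral_ge0 => x _; rewrite lee_fin mulr_ge0// powR_ge0.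
have pi0 : (0 <= p^-1)%R by rewrite invr_ge0 ltW.
have eps : (p / s * p^-1 = s^-1)%R by field; rewrite !gt_eqF.
have {IJ} := ge0_le_poweR pi0 (mule_ge0 (poweR_ge0 _ _) (wmeas_ge0 _ wv)) IJ.
rewrite !poweRM ?mule_ge0 ?poweR_ge0 ?(wmeas_ge0 _ wv) ?lee_fin ?(ltW C0)//.
rewrite -!poweRrM eps -/(Lp_norm p u B g) poweR_EFin => IJ.
have lebB : leb B `^ s^-1 <= ((2 ^+ n) `^ s^-1 * r `^ (n%:R / s))%:E.
  have -> : (r `^ (n%:R / s) = (r ^+ n) `^ s^-1)%R.
    by rewrite -powR_mulrn ?(ltW r0)// -powRrM.
  rewrite -powRM ?exprn_ge0 ?(ltW r0)// -exprMn -poweR_EFin.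
  apply: ge0_le_poweR; rewrite ?invr_ge0 ?(ltW s0) ?lebesgue_outer_ge0//.
  by apply: leb_eball_le; exact: ltW.
have rr : (r `^ (- (n%:R / s)) * r `^ (n%:R / s) = 1)%R.
  by rewrite powRN mulVf// powR_eq0 gt_eqF.
rewrite -muleA (le_trans (lee_wpmul2l _ IJ)) ?lee_fin ?powR_ge0//.
have L0 : 0 <= Lp_norm p u B g by exact: poweR_ge0.
rewrite !muleA; apply: lee_wpmul2r => //.
rewrite -muleA (le_trans (lee_wpmul2l _ (lee_wpmul2l _ lebB)))//.
- by rewrite lee_fin powR_ge0.
- by rewrite lee_fin powR_ge0.
rewrite -!EFinM lee_fin /K le_eqVlt; apply/orP; left; apply/eqP.
by rewrite [LHS]mulrCA [X in (_ * X)%R]mulrCA rr mulr1.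
Qed.

(** What the proof uses of the norm in which S f is measured, with the same
    properties for the strong and the weak norm. In the last one, h1 stands for
    S f1 and M for the bound on S f2, which may be infinite. *)
Definition local_norm (p : R) v (N : set V -> (V -> R) -> \bar R) : Prop :=
  [/\ forall E h, 0 <= N E h,
      forall (E : set V) (h : V -> R), measurable E -> measurable_fun setT h ->
        wmeas v E = 0 -> N E h = 0 &
      exists2 K : R, (0 < K)%R &
      forall (E : set V) (h h1 : V -> R) (M : \bar R), measurable E ->
        measurable_fun setT h -> measurable_fun setT h1 -> 0 <= M ->
        {ae leb, forall x, E x -> `|h x|%:E <= `|h1 x|%:E + M} ->
        N E h <= K%:E * (N setT h1 + wmeas v E `^ p^-1 * M)].

Lemma poweR_add_le (e : R) (x y : \bar R) : (0 <= e)%R -> 0 <= x -> 0 <= y ->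
  (x + y) `^ e <= (2 `^ e)%:E * (x `^ e + y `^ e).
Proof.
move=> e0 x0 y0; have lexx2 (z : \bar R) : 0 <= z -> z + z = 2%:E * z.
  by move=> z0; rewrite (_ : 2%:E = 1%:E + 1%:E)// ge0_muleDl ?lee_fin// !mul1e.
have le2 z : 0 <= z -> x + y <= 2%:E * z -> z `^ e <= x `^ e + y `^ e ->
    (x + y) `^ e <= (2 `^ e)%:E * (x `^ e + y `^ e).
  move=> z0 xyz ze; apply: (@le_trans _ _ ((2%:E * z) `^ e)).
    by apply: ge0_le_poweR => //; exact: adde_ge0.
  by rewrite poweRM// poweR_EFin lee_wpmul2l// lee_fin powR_ge0.
case: (leP x y) => [xy|/ltW yx].
- by apply: (le2 y) => //; rewrite -?lexx2// ?leeD2r// leeDr// poweR_ge0.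
- by apply: (le2 x) => //; rewrite -?lexx2// ?leeD2l// leeDl// poweR_ge0.
Qed.

(** The inequality (|h1| + M)^p <= 2^p (|h1|^p + M^p), integrated over E, and
    once more the quasi-triangle inequality, for the power 1/p. An infinite M
    makes the right-hand side infinite unless E has measure zero. *)
Lemma Lp_local_norm (p : R) v : (1 <= p)%R -> weight v ->
  local_norm p v (Lp_norm p v).
Proof.
move=> p1 wv; have p0 : (0 < p)%R by lra.
have [mv v0 _ _] := wv.
have K0 : (0 < 2 * 2 `^ p^-1 :> R)%R by rewrite mulr_gt0// powR_gt0.
split=> [E h|E h mE mh|]; [exact: poweR_ge0|exact: Lp_norm0|].
exists (2 * 2 `^ p^-1)%R => // E h h1 M mE mh mh1 M0 hM.
have [vE0|vEn0] := eqVneq (wmeas v E) 0.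
  by rewrite Lp_norm0// mule_ge0 ?adde_ge0 ?mule_ge0 ?poweR_ge0// lee_fin ltW.
have vE : 0 < wmeas v E by rewrite lt_neqAle eq_sym vEn0 wmeas_ge0.
case: M M0 hM => [M| |//]; last first.
  move=> _ _; rewrite gt0_muley ?poweR_gt0// addey ?gt0_muley ?leey//.
  by rewrite gt_eqF// (lt_le_trans _ (poweR_ge0 _ _)).
rewrite lee_fin => M0 hM; rewrite /Lp_norm.
set I := \int[leb]_(x in E) _; set J := \int[leb]_(x in setT) _.
have hv0 (f : V -> R) x : 0 <= (`|f x| `^ p * v x)%:E.
  by rewrite lee_fin mulr_ge0// powR_ge0.
have I0 : 0 <= I by exact: integral_ge0.
have J0 : 0 <= J by exact: integral_ge0.
have mhv (f : V -> R) : measurable_fun setT f ->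
    measurable_fun setT (fun x => (`|f x| `^ p * v x)%:E).
  move=> mf; apply/measurable_EFinP; apply: measurable_funM; last exact: mv.
  apply: (measurableT_comp (@measurable_powR R p)).
  exact: (measurableT_comp (@normr_measurable R setT) mf).
have IJ : I <= (2 `^ p)%:E * (J + (M `^ p)%:E * wmeas v E).
  apply: (@le_trans _ _ ((2 `^ p)%:E * \int[leb]_(x in E)
      ((`|h1 x| `^ p * v x)%:E + (M `^ p)%:E * (v x)%:E))).
    apply: ae_le_integral_scale; rewrite ?powR_gt0//.
      by move=> x _; rewrite adde_ge0// mule_ge0// lee_fin// powR_ge0.
    apply: filterS hM => x hM Ex; have {hM} := hM Ex.
    rewrite -EFinD -!EFinM !lee_fin => hM.
    rewrite -mulrDl mulrA ler_wpM2r// -lee_fin.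
    apply: (@le_trans _ _ ((`|h1 x| + M) `^ p)%:E).
      by rewrite lee_fin ge0_ler_powR ?(ltW p0) ?nnegrE ?addr_ge0.
    rewrite EFinM EFinD -!poweR_EFin EFinD.
    by apply: poweR_add_le; rewrite ?lee_fin ?(ltW p0).
  have mvE : measurable_fun E (EFin \o v).
    by apply: measurable_funTS; exact/measurable_EFinP.
  have vE_ge0 x : E x -> 0 <= (v x)%:E by rewrite lee_fin.
  have Mp0 : 0 <= (M `^ p)%:E by rewrite lee_fin powR_ge0.
  rewrite (ge0_integralD leb mE _ (measurable_funTS (mhv _ mh1))); last 3 first.
  - by move=> x _; exact: hv0.
  - by move=> x Ex; rewrite mule_ge0// vE_ge0.
  - by apply: measurable_funeM; exact: mvE.
  rewrite (ge0_integralZl leb mE mvE vE_ge0 Mp0).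
  apply: lee_wpmul2l; first by rewrite lee_fin powR_ge0.
  by apply/leeD2r/le_integral_subset => // x _; rewrite hv0 lexx.
have pi0 : (0 <= p^-1)%R by rewrite invr_ge0 ltW.
apply: (le_trans (ge0_le_poweR pi0 I0 IJ)).
have Mw0 : 0 <= (M `^ p)%:E * wmeas v E.
  by rewrite mule_ge0 ?wmeas_ge0 ?lee_fin ?powR_ge0.
have JMw0 := adde_ge0 J0 Mw0.
rewrite poweRM ?JMw0 ?lee_fin ?powR_ge0//.
rewrite poweR_EFin -powRrM divff ?gt_eqF// powRr1// EFinM -muleA.
rewrite lee_wpmul2l//; apply: (le_trans (poweR_add_le pi0 J0 Mw0)).
rewrite lee_wpmul2l ?lee_fin ?powR_ge0// leeD2l//.
rewrite poweRM ?wmeas_ge0 ?lee_fin ?powR_ge0// poweR_EFin -powRrM.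
by rewrite divff ?gt_eqF// powRr1// muleC.
Qed.

(** A level gam is either at most 2 M, and then the measure of all of E is
    enough, or larger, and then |h| > gam forces |h1| > gam / 2. *)
Lemma weak_Lp_local_norm (p : R) v : (1 <= p)%R -> weight v ->
  local_norm p v (weak_Lp_norm p v).
Proof.
move=> p1 wv; have p0 : (0 < p)%R by lra.
have pi0 : (0 <= p^-1)%R by rewrite invr_ge0 ltW.
have [mv v0 _ _] := wv.
have N0 (E : set V) h : 0 <= weak_Lp_norm p v E h.
  apply: (@le_trans _ _
    (1%:E * wmeas v [set x | E x /\ (1 < `|h x|)%R] `^ p^-1)).
    by rewrite mule_ge0// poweR_ge0.
  by apply: ereal_sup_ubound; exists 1%R => //=; exact: ltr01.
split=> // [E h mE mh E0|].
  apply/eqP; rewrite eq_le N0 andbT; apply: ge_ereal_sup => _ [gam gam0 <-].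
  suff -> : wmeas v [set x | E x /\ (gam < `|h x|)%R] = 0.
    by rewrite poweR0r ?invr_eq0 ?gt_eqF// mule0.
  apply/eqP; rewrite eq_le wmeas_ge0// andbT -E0.
  by apply: le_wmeas => // x [].
exists 2%R => // E h h1 M mE mh mh1 M0 hM.
apply: ge_ereal_sup => _ [gam /= gam0 <-].
have [gM|Mg] := leP ((gam / 2)%:E) M.
  apply: (@le_trans _ _ (gam%:E * wmeas v E `^ p^-1)).
    rewrite lee_wpmul2l ?lee_fin ?(ltW gam0)//.
    apply: ge0_le_poweR; rewrite ?wmeas_ge0//.
    by apply: le_wmeas => // x [].
  rewrite ge0_muleDr ?mule_ge0 ?poweR_ge0//.
  apply: (@le_trans _ _ (2%:E * (wmeas v E `^ p^-1 * M))); last first.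
    by rewrite leeDr// mule_ge0.
  rewrite [leRHS]muleC -muleA [leLHS]muleC lee_wpmul2l ?poweR_ge0//.
  by rewrite -lee_pdivrMr.
rewrite ge0_muleDr ?mule_ge0 ?poweR_ge0//.
apply: (@le_trans _ _ (2%:E * weak_Lp_norm p v setT h1)); last first.
  by rewrite leeDl// !mule_ge0// poweR_ge0.
have -> : gam%:E = 2%:E * (gam / 2)%:E.
  by rewrite -EFinM mulrC divfK.
rewrite -muleA lee_wpmul2l//.
apply: (@le_trans _ _ ((gam / 2)%:E *
   wmeas v [set x | setT x /\ (gam / 2 < `|h1 x|)%R] `^ p^-1)); last first.
  by apply: ereal_sup_ubound; exists (gam / 2)%R => //=; lra.
apply: lee_wpmul2l; first by rewrite lee_fin; lra.
apply: ge0_le_poweR; rewrite ?wmeas_ge0//.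
rewrite /wmeas integral_mkcond [leRHS]integral_mkcond.
apply: ae_le_integral.
- by move=> x _; apply: erestrict_ge0 => y _; rewrite lee_fin.
- by move=> x _; apply: erestrict_ge0 => y _; rewrite lee_fin.
apply: filterS hM => x hM _; rewrite [leLHS]patchE; case: ifPn => [/set_mem|_].
  move=> [/hM {}hM gh]; rewrite patchE mem_set//; split=> //.
  rewrite -lte_fin; have : gam%:E < `|h1 x|%:E + M.
    by apply: lt_le_trans hM; rewrite lte_fin.
  move: M M0 Mg {hM} => [M| |]//; rewrite -EFinD !lte_fin => _; lra.
by apply: erestrict_ge0 => y _; rewrite lee_fin.
Qed.

(** * Dyadic sums and the integral condition *)

Lemma inve_le_scale (K : R) (x y : \bar R) : (0 < K)%R -> 0 < x < +oo ->
  0 < y < +oo -> x <= K%:E * y -> y^-1 <= K%:E * x^-1.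
Proof.
move=> K0; case: x => [x| |]; case: y => [y| |]; rewrite ?ltxx ?andbF//.
move=> /andP[+ _] /andP[+ _]; rewrite !lte_fin => x0 y0.
rewrite !inver !gt_eqF// -!EFinM !lee_fin => xy.
by rewrite ler_pdivlMr// ler_pdivrMl// mulrC.
Qed.

(** The step function equal to Phi(2^k r) / W(2^k r) / (2^k r) on the interval
    from 2^k r to 2^(k+1) r has the sum as its integral. On that interval Phi
    has increased, W has grown at most by the factor K and t at most by the
    factor 2, so that the step function is at most 2 K times the integrand. *)
Lemma dyadic_sum_le_integral (Phi W : R -> \bar R) (K r : R) :
  (0 < r)%R -> (0 < K)%R ->
  (forall t, (r <= t)%R -> 0 <= Phi t) ->
  (forall t t', (r <= t)%R -> (t <= t')%R -> Phi t <= Phi t') ->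
  (forall t, (r <= t)%R -> 0 < W t < +oo) ->
  (forall t t', (r <= t)%R -> (t <= t')%R -> (t' <= 2 * t)%R ->
    W t' <= K%:E * W t) ->
  \sum_(0 <= k <oo) (Phi (2 ^+ k * r)%R / W (2 ^+ k * r)%R) <=
  (2 * K)%:E *
    \int[lebesgue_measure]_(t in `]r, +oo[) (Phi t / W t * (t^-1)%:E).
Proof.
move=> r0 K0 Phi0 Phind W0 Wdbl.
pose rho k : R := (2 ^+ k * r)%R.
have rho0 k : (0 < rho k)%R by rewrite mulr_gt0// exprn_gt0.
have rhoS k : rho k.+1 = (2 * rho k)%R by rewrite /rho exprS mulrA.
have rhor k : (r <= rho k)%R.
  by rewrite /rho ler_peMl ?(ltW r0)// exprn_ege1// ler1n.
have rho_mono j k : (j <= k)%N -> (rho j <= rho k)%R.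
  by move=> jk; rewrite /rho ler_pM2r// ler_eXn2l// ltr1n.
pose d k := Phi (rho k) / W (rho k).
have d0 k : 0 <= d k.
  by rewrite mule_ge0 ?Phi0// inve_ge0 ltW//; case/andP: (W0 _ (rhor k)).
pose I k : set R := `]rho k, rho k.+1]%classic.
pose c k := d k * ((rho k)^-1)%:E.
have c0 k : 0 <= c k by rewrite mule_ge0// lee_fin invr_ge0 ltW.
pose D : set R := `]r, +oo[%classic.
have Dr t : D t -> (r < t)%R by rewrite /D /= in_itv/= andbT.
have mD : measurable D by exact: measurable_itv.
have mI k : measurable (I k) by exact: measurable_itv.
have f0 k t : 0 <= c k * (\1_(I k) t)%:E by rewrite mule_ge0// lee_fin.
have mf k : measurable_fun D (fun t => (\1_(I k) t : R)%:E).
  by apply/measurable_EFinP; exact: measurable_indic.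
have -> : \sum_(0 <= k <oo) (Phi (2 ^+ k * r)%R / W (2 ^+ k * r)%R) =
    \int[lebesgue_measure]_(t in D)
      (\sum_(0 <= k <oo) (c k * (\1_(I k) t)%:E)).
  rewrite integral_nneseries//; last first.
    by move=> k; apply: emeasurable_funM; [exact: measurable_cst|exact: mf].
  apply: eq_eseriesr => k _.
  rewrite ge0_integralZl//; last exact: mf.
  have -> : \int[lebesgue_measure]_(t in D) (\1_(I k) t)%:E = (rho k)%:E.
    rewrite [LHS](_ : _ = lebesgue_measure (I k `&` D)); last first.
      by have := integral_indic
        (lebesgue_measure : {measure set (measurableTypeR R) -> \bar R})
        mD (mI k).
    rewrite setIidl; last first.
      move=> t; rewrite /I /D /= !in_itv/= andbT => /andP[+ _].
      exact: le_lt_trans.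
    rewrite /I lebesgue_measure_itv/= lte_fin rhoS ltr_pMl// ltr1n -EFinD.
    by rewrite mulrDl mul1r addrK.
  by rewrite /c -muleA -EFinM mulVf ?gt_eqF// mule1.
apply: ae_le_integral_scale.
- by rewrite mulr_gt0.
- by move=> t _; apply: nneseries_ge0 => k _ _.
- move=> t /Dr rt; have rt' := ltW rt.
  rewrite !mule_ge0 ?Phi0// ?inve_ge0.
    by case/andP: (W0 t rt') => /ltW.
  by rewrite lee_fin invr_ge0 (le_trans (ltW r0)).
apply: nearW => t /Dr rt.
have t0 : (0 < t)%R by rewrite (lt_trans r0).
have Wt := W0 t (ltW rt); have /andP[Wt0 _] := Wt.
have G0 : 0 <= (2 * K)%:E * (Phi t / W t * (t^-1)%:E).
  rewrite !mule_ge0 ?Phi0 ?(ltW rt) ?inve_ge0 ?(ltW Wt0)//.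
  - by rewrite lee_fin mulr_ge0// ltW.
  - by rewrite lee_fin invr_ge0 ltW.
(* At most one of the intervals contains t, and only its term survives. *)
have [[j tj]|nt] := pselect (exists j, I j t); last first.
  rewrite eseries0// => k _ _; rewrite indicE memNset ?mule0// => It.
  by apply: nt; exists k.
rewrite (nneseriesD1 (n := j))//= eseries0 ?adde0; last first.
  move=> k _ /eqP kj; rewrite indicE memNset ?mule0//.
  move: tj; rewrite /I /= !in_itv/= => /andP[jt tj] /andP[kt tk].
  have [jk|jk] := ltnP j k.
    by have := lt_le_trans (lt_le_trans kt tj) (rho_mono _ _ jk); rewrite ltxx.
  have {}jk : (k < j)%N by rewrite ltn_neqAle jk andbT; apply/eqP.
  by have := lt_le_trans (lt_le_trans jt tk) (rho_mono _ _ jk); rewrite ltxx.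
rewrite indicE mem_set// mule1 /c /d.
move: tj; rewrite /I /= in_itv/= rhoS => /andP[jt tj].
have WV : (W (rho j))^-1 <= K%:E * (W t)^-1.
  by apply: inve_le_scale => //; [exact: W0|exact: Wdbl (rhor j) (ltW jt) tj].
apply: (@le_trans _ _ (Phi t * (K%:E * (W t)^-1) * (2 * t^-1)%:E)).
  apply: lee_pmul.
  - exact: d0.
  - by rewrite lee_fin invr_ge0 ltW.
  - apply: lee_pmul; rewrite ?Phi0 ?inve_ge0//.
    + by have /andP[/ltW] := W0 _ (rhor j).
    + exact: Phind (ltW jt).
  - by rewrite lee_fin ler_pdivlMr// ler_pdivrMl// mulrC.
rewrite le_eqVlt; apply/orP; left; apply/eqP.
by rewrite !EFinM [Phi t * _]muleCA muleACA [K%:E * _]muleC.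
Qed.

(** * The local estimate *)

Lemma nneseries_ge_term (F : nat -> \bar R) k : (forall i, 0 <= F i) ->
  F k <= \sum_(0 <= i <oo) F i.
Proof.
move=> F0; rewrite (nneseriesD1 (n := k))// leeDl//.
by apply: nneseries_ge0 => i _ _.
Qed.

Lemma nneseries_shift_le (F : nat -> \bar R) : (forall i, 0 <= F i) ->
  \sum_(1 <= i <oo) F i.+1 <= \sum_(0 <= i <oo) F i.
Proof.
move=> F0; apply: (@le_trans _ _ (\sum_(0 <= i <oo) F i.+1)).
  by rewrite [leRHS]nneseries_recl// leeDr.
under eq_eseriesr do rewrite -addn1.
by rewrite (nneseries_addn 1)// [leRHS]nneseries_recl// leeDr.
Qed.

Lemma Lp_norm_cut (p : R) u (B : set V) g : (0 < p)%R ->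
  Lp_norm p u setT (fun x => g x * \1_B x)%R = Lp_norm p u B g.
Proof.
move=> p0; rewrite /Lp_norm [in RHS]integral_mkcond; congr (_ `^ _).
apply: eq_integral => x _; rewrite patchE indicE; case: ifPn => _.
  by rewrite mulr1.
by rewrite mulr0 normr0 powR0 ?gt_eqF// mul0r.
Qed.

Lemma wmeas_poweR_fin (e : R) v a r t : weight v -> (r <= t)%R ->
  wmeas v (eball a r) != 0 ->
  exists2 c : R, (0 < c)%R & wmeas v (eball a t) `^ e = c%:E.
Proof.
move=> wv rt v0.
have vt0 : 0 < wmeas v (eball a t).
  apply: (@lt_le_trans _ _ (wmeas v (eball a r))).
    by rewrite lt_neqAle eq_sym v0 wmeas_ge0.
  exact/le_wmeas/subset_eball.
have vf : wmeas v (eball a t) \is a fin_num.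
  by rewrite ge0_fin_numE ?(ltW vt0)// wmeas_eball_lty.
exists (fine (wmeas v (eball a t)) `^ e)%R; last first.
  by rewrite -poweR_EFin fineK.
by rewrite powR_gt0// fine_gt0// vt0 ltey_eq vf.
Qed.

(** The discrete form of the integral in the condition on psi1 and psi2, with
    the actual norms of f in place of their bounds. *)
Definition dyadic_sum (p : R) (w1 w2 : V -> R) f a r : \bar R :=
  \sum_(0 <= k <oo) (Lp_norm p w1 (eball a (2 ^+ k * r)) f /
                     wmeas w2 (eball a (2 ^+ k * r)) `^ p^-1).

Let dyadic_term_ge0 (p : R) (w1 w2 : V -> R) f a (rho : R) :
  0 <= Lp_norm p w1 (eball a rho) f / wmeas w2 (eball a rho) `^ p^-1.
Proof. by apply: mule_ge0; [|rewrite inve_ge0]; exact: poweR_ge0. Qed.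

Lemma dyadic_sum_ge0 (p : R) (w1 w2 : V -> R) f a r :
  0 <= dyadic_sum p w1 w2 f a r.
Proof. by apply: nneseries_ge0 => k _ _; exact: dyadic_term_ge0. Qed.

(** The left-hand side is w2(B(a,2r))^(1/p) times the term k = 1 of the sum,
    and by doubling that factor is at most a multiple of w2(B(a,r))^(1/p). *)
Lemma near_part_le (p q : R) (w1 w2 : V -> R) : (0 < p)%R -> (1 <= q)%R ->
  weight w2 -> Ap_class q w2 w2 ->
  exists2 K : R, (0 < K)%R & forall f a r, (0 < r)%R ->
    wmeas w2 (eball a r) != 0 ->
    Lp_norm p w1 (eball a (2 * r)) f <=
    K%:E * (wmeas w2 (eball a r) `^ p^-1 * dyadic_sum p w1 w2 f a r).
Proof.
move=> p0 q1 wt2 A22; have pi0 : (0 <= p^-1)%R by rewrite invr_ge0 ltW.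
have [K K0 hK] := Ap_doubling q1 wt2 A22.
exists (K `^ p^-1)%R; first exact: powR_gt0.
move=> f a r r0 w2n0; rewrite muleA.
set L := Lp_norm _ _ _ _.
have -> : L = wmeas w2 (eball a (2 * r)) `^ p^-1 *
              (L / wmeas w2 (eball a (2 * r)) `^ p^-1).
  have r2 : (r <= 2 * r)%R by lra.
  have [c c0 ->] := wmeas_poweR_fin p^-1 wt2 r2 w2n0.
  by rewrite muleCA inver gt_eqF -?EFinM ?divff ?mule1 ?gt_eqF.
apply: lee_pmul; [exact: poweR_ge0|exact: dyadic_term_ge0| |].
  rewrite -poweR_EFin -(poweRM _ _ (wmeas_ge0 _ wt2)); last first.
    by rewrite lee_fin ltW.
  by apply: (ge0_le_poweR pi0 (wmeas_ge0 _ wt2)); exact: hK.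
have := @nneseries_ge_term _ 1%N
  (fun k => dyadic_term_ge0 p w1 w2 f a (2 ^+ k * r)).
by rewrite expr1.
Qed.

(** Each average of |f|^s on the ball of radius 2^(k+1) r is at most a multiple
    of the term k+1 of the dyadic sum, by Hoelder's inequality and the A_q
    condition on the pair (w1,w2). *)
Lemma far_part_le (p s : R) (w1 w2 : V -> R) : (1 <= s)%R -> (s <= p)%R ->
  weight w1 -> weight w2 -> Ap_class (p / s) w1 w2 ->
  exists2 K : R, (0 < K)%R & forall (f : V -> R) a r, (0 < r)%R ->
    measurable_fun setT f -> wmeas w2 (eball a r) != 0 ->
    \sum_(1 <= k <oo) (((2 ^+ k.+1 * r) `^ (- (n%:R / s)))%R%:E *
      (\int[leb]_(y in eball a (2 ^+ k.+1 * r)%R) (`|f y| `^ s)%:E) `^ s^-1) <=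
    K%:E * dyadic_sum p w1 w2 f a r.
Proof.
move=> s1 sp wt1 wt2 A12; have [K K0 hK] := Ap_Lp_bound s1 sp wt1 wt2 A12.
exists K => // f a r r0 mf w2n0.
pose F k := Lp_norm p w1 (eball a (2 ^+ k * r)) f /
            wmeas w2 (eball a (2 ^+ k * r)) `^ p^-1.
have F0 k : 0 <= F k by exact: dyadic_term_ge0.
apply: (@le_trans _ _ (\sum_(1 <= k <oo) (K%:E * F k.+1))).
  apply: lee_nneseries => [k _ _|k _].
    by apply: mule_ge0; [rewrite lee_fin powR_ge0|exact: poweR_ge0].
  have rk : (r <= 2 ^+ k.+1 * r)%R.
    by rewrite ler_peMl ?(ltW r0)// exprn_ege1// ler1n.
  have := hK a _ f (lt_le_trans r0 rk) mf; rewrite /F.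
  have [c c0 ->] := wmeas_poweR_fin p^-1 wt2 rk w2n0.
  by rewrite inver gt_eqF// muleA lee_pdivlMr.
rewrite nneseriesZl; last by move=> k _; exact: F0.
by apply: lee_wpmul2l; [rewrite lee_fin ltW|exact: nneseries_shift_le].
Qed.

(** Split f at the ball B(a,2r): the boundedness of S on the whole space and
    near_part_le deal with the part inside, the size condition and far_part_le
    with the part outside. *)
Lemma sublinear_local_estimate (p s : R) (w1 w2 : V -> R)
    (D : set (V -> R)) (S : (V -> R) -> V -> R)
    (N : set V -> (V -> R) -> \bar R) :
  (1 <= s)%R -> (s <= p)%R -> weight w1 -> weight w2 ->
  Ap_class (p / s) w1 w2 -> Ap_class (p / s) w2 w2 ->
  sublinear_op D S -> finite_norm_space (Lp_norm p w1 setT) `<=` D ->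
  size_condition s D S -> local_norm p w2 N ->
  bounded_op S (Lp_norm p w1 setT) (N setT) ->
  exists2 K : R, (0 < K)%R & forall f a r, D f -> (0 < r)%R ->
    Lp_norm p w1 (eball a (2 * r)) f < +oo ->
    N (eball a r) (S f) <=
    K%:E * (wmeas w2 (eball a r) `^ p^-1 * dyadic_sum p w1 w2 f a r).
Proof.
move=> s1 sp wt1 wt2 A12 A22 hS hDL [C0 C00 hsize] [N0 Nnull [K2 K20 hN]].
move=> [C1 C10 hB].
have p0 : (0 < p)%R by lra.
have q1 : (1 <= p / s)%R by rewrite ler_pdivlMr ?mul1r//; lra.
have [K1 K10 hK1] := far_part_le s1 sp wt1 wt2 A12.
have [Kn Kn0 hKn] := near_part_le w1 p0 q1 wt2 A22.
pose K := (K2 * (C1 * Kn + C0 * K1))%R.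
have K0 : (0 < K)%R by rewrite mulr_gt0// addr_gt0// mulr_gt0.
exists K => // f a r Df r0 Lf.
have mB t : measurable (eball a t) by exact: measurable_eball.
have mf := sublinear_dom_meas hS Df.
have mSf := sublinear_meas hS Df.
have Sg0 := dyadic_sum_ge0 p w1 w2 f a r.
have W0 := poweR_ge0 (wmeas w2 (eball a r)) p^-1.
(* If w2(B(a,r)) = 0 the inverse powers in the sum can be infinite, and the
   estimate holds because its left-hand side is zero. *)
have [w20|w2n0] := eqVneq (wmeas w2 (eball a r)) 0.
  rewrite (Nnull _ _ (mB r) mSf w20); apply: mule_ge0; last exact: mule_ge0.
  by rewrite lee_fin ltW.
pose f1 : V -> R := fun x => (f x * \1_(eball a (2 * r)) x)%R.
pose g : V -> R := fun x => (f x * \1_(~` eball a (2 * r)) x)%R.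
have mf1 : measurable_fun setT f1.
  by apply: measurable_funM; [exact: mf|exact: measurable_indic].
have Lf1 : Lp_norm p w1 setT f1 = Lp_norm p w1 (eball a (2 * r)) f.
  exact: Lp_norm_cut.
have Nf1 : finite_norm_space (Lp_norm p w1 setT) f1.
  by split; [exact: mf1|rewrite Lf1].
have Df1 : D f1 by exact: hDL.
have indicC x : (\1_(~` eball a (2 * r)) x = 1 - \1_(eball a (2 * r)) x :> R)%R.
  by rewrite !indicE in_setC; case: (x \in _); rewrite ?subrr ?subr0.
(* f and f1 are in D, which is closed under linear combinations. *)
have Dg : D g.
  have -> : g = (f \+ (fun x => -1 * f1 x))%R.
    by apply/funext => x; rewrite /g /f1 /= indicC; ring.
  exact: (sublinear_domD hS Df (sublinear_domZ hS (-1)%R Df1)).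
have fE : (f1 \+ g)%R = f.
  by apply/funext => x; rewrite /g /f1 /= indicC; ring.
have := sublinearD hS Df1 Dg; rewrite fE => Sadd.
have [_] := hB f1 Nf1; rewrite Lf1 => near.
have := hsize f a r r0 Df Dg; have := hK1 f a r r0 mf w2n0.
have := hKn f a r r0 w2n0.
have M00 : 0 <= \sum_(1 <= k <oo) (((2 ^+ k.+1 * r) `^ (- (n%:R / s)))%R%:E *
    (\int[leb]_(y in eball a (2 ^+ k.+1 * r)%R) (`|f y| `^ s)%:E) `^ s^-1).
  apply: nneseries_ge0 => k _ _.
  by apply: mule_ge0; [rewrite lee_fin powR_ge0|exact: poweR_ge0].
move: M00 near; rewrite -/g.
(* From here on, only the inequalities between these quantities matter. *)
move: (\sum_(1 <= k <oo) _) (Lp_norm p w1 (eball a (2 * r)) f) => M L.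
move=> M0 near hL hM hg.
have Npiece := hN (eball a r) (S f) (S f1) (C0%:E * M) (mB r) mSf
  (sublinear_meas hS Df1).
have {}Npiece : N (eball a r) (S f) <=
    K2%:E * (N setT (S f1) + wmeas w2 (eball a r) `^ p^-1 * (C0%:E * M)).
  apply: Npiece; first by apply: mule_ge0 M0; rewrite lee_fin ltW.
  apply: filterS Sadd => x Sx Bx.
  apply: (@le_trans _ _ (`|S f1 x|%:E + `|S g x|%:E)).
    by rewrite -EFinD lee_fin.
  apply: leeD2l; apply: le_trans hg; apply: ereal_sup_ubound.
  by exists x.
apply: (le_trans Npiece); rewrite /K EFinM -muleA.
move: Sg0 W0 hL hM; move: (dyadic_sum _ _ _ _ _ _) (_ `^ p^-1) => A W.
move=> A0 W0 hL hM; apply: lee_wpmul2l; first by rewrite lee_fin ltW.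
have C1Kn : 0 <= (C1 * Kn)%:E by rewrite lee_fin; apply: mulr_ge0; exact: ltW.
have C0K1 : 0 <= (C0 * K1)%:E by rewrite lee_fin; apply: mulr_ge0; exact: ltW.
rewrite EFinD (ge0_muleDl _ C1Kn C0K1); apply: leeD.
  apply: (le_trans near); rewrite EFinM -muleA.
  by apply: lee_wpmul2l; [rewrite lee_fin ltW|exact: hL].
rewrite muleCA EFinM -muleA; apply: lee_wpmul2l; first by rewrite lee_fin ltW.
by rewrite [leRHS]muleCA; exact: lee_wpmul2l.
Qed.
(** * Morrey spaces *)

(** The strong and the weak Morrey norm are, by conversion, the cases where N
    is Lp_norm p v and weak_Lp_norm p v. *)
Definition gen_morrey_norm (psi : V -> R -> R) (p : R) v
    (N : set V -> (V -> R) -> \bar R) f : \bar R :=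
  ereal_sup [set ((psi (ar : V * R).1 ar.2)^-1)%:E
                 * (wmeas v (eball ar.1 ar.2) `^ p^-1)^-1
                 * N (eball ar.1 ar.2) f
            | ar in [set ar | (0 < ar.2)%R]].

Lemma gen_morrey_norm_ge0 psi (p : R) v N f : positive_on psi ->
  (forall E h, 0 <= N E h) -> 0 <= gen_morrey_norm psi p v N f.
Proof.
move=> psi0 N0; apply: (@le_trans _ _ (((psi point 1%R)^-1)%:E
  * (wmeas v (eball point 1%R) `^ p^-1)^-1 * N (eball point 1%R) f)).
  apply: mule_ge0; last exact: N0.
  apply: mule_ge0; last by rewrite inve_ge0; exact: poweR_ge0.
  by rewrite lee_fin invr_ge0 ltW// psi0.
by apply: ereal_sup_ubound; exists (point, 1%R) => //=; exact: ltr01.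
Qed.

Lemma Lp_norm_le_morrey psi (p : R) v f a r : (0 < p)%R -> weight v ->
  positive_on psi -> measurable_fun setT f -> (0 < r)%R ->
  Lp_norm p v (eball a r) f <=
  morrey_norm psi p v f * ((psi a r)%:E * wmeas v (eball a r) `^ p^-1).
Proof.
move=> p0 wv psi0 mf r0.
have N0 : 0 <= morrey_norm psi p v f.
  by apply: gen_morrey_norm_ge0 => // E h; exact: poweR_ge0.
have [v0|vn0] := eqVneq (wmeas v (eball a r)) 0.
  rewrite (Lp_norm0 p0 wv (measurable_eball a r) mf v0).
  apply: mule_ge0 => //; apply: mule_ge0; last exact: poweR_ge0.
  by rewrite lee_fin ltW// psi0.
have [c c0 cE] := wmeas_poweR_fin p^-1 wv (lexx r) vn0.
have psir : (0 < psi a r)%R by exact: psi0.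
have : ((psi a r)^-1)%:E * (wmeas v (eball a r) `^ p^-1)^-1 *
    Lp_norm p v (eball a r) f <= morrey_norm psi p v f.
  by apply: ereal_sup_ubound; exists (a, r).
rewrite cE inver gt_eqF// -EFinM -invfM -EFinM muleC.
by rewrite lee_pdivrMr// mulr_gt0.
Qed.

(** The norm on B(a,r) is at most the norm on every larger ball B(a,l), each of
    which the Morrey norm controls. *)
Lemma Lp_norm_le_inf_morrey psi (p : R) v f a r : (0 < p)%R -> weight v ->
  positive_on psi -> measurable_fun setT f -> (0 < r)%R ->
  morrey_norm psi p v f < +oo ->
  Lp_norm p v (eball a r) f <= morrey_norm psi p v f *
  ereal_inf [set (psi a l)%:E * wmeas v (eball a l) `^ p^-1 | l in `[r, +oo[].
Proof.
move=> p0 wv psi0 mf r0 Moo.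
have M0 : 0 <= morrey_norm psi p v f.
  by apply: gen_morrey_norm_ge0 => // E h; exact: poweR_ge0.
have hle l : (r <= l)%R -> Lp_norm p v (eball a r) f <=
    morrey_norm psi p v f * ((psi a l)%:E * wmeas v (eball a l) `^ p^-1).
  move=> rl; apply: (@le_trans _ _ (Lp_norm p v (eball a l) f)).
    exact/le_Lp_norm/subset_eball.
  by apply: Lp_norm_le_morrey => //; exact: lt_le_trans rl.
move: M0 Moo hle; case: (morrey_norm _ _ _ _) => [M| |]// + _ hle.
rewrite lee_fin le_eqVlt => /orP[/eqP M0|M0].
  by have := hle r (lexx r); rewrite -M0 !mul0e.
rewrite muleC -lee_pdivrMr//; apply: le_ereal_inf_tmp => _ [l /= + <-].
rewrite in_itv/= andbT => rl.
by rewrite lee_pdivrMr// muleC; exact: hle.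
Qed.

(** By the local estimate, S f on B(a,r) is bounded by the dyadic sum; by
    Lp_norm_le_inf_morrey and dyadic_sum_le_integral that sum is at most a
    multiple of the integral in the condition on psi1 and psi2. *)
Lemma bounded_on_morrey (p s : R) (w1 w2 : V -> R) (psi1 psi2 : V -> R -> R)
    (D : set (V -> R)) (S : (V -> R) -> V -> R)
    (N : set V -> (V -> R) -> \bar R) :
  (1 <= s)%R -> (s <= p)%R -> weight w1 -> weight w2 ->
  Ap_class (p / s) w1 w2 -> Ap_class (p / s) w2 w2 ->
  sublinear_op D S -> finite_norm_space (Lp_norm p w1 setT) `<=` D ->
  finite_norm_space (morrey_norm psi1 p w1) `<=` D ->
  size_condition s D S -> positive_on psi1 -> positive_on psi2 ->
  psi_condition p w1 w2 psi1 psi2 -> local_norm p w2 N ->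
  bounded_op S (Lp_norm p w1 setT) (N setT) ->
  bounded_op S (morrey_norm psi1 p w1) (gen_morrey_norm psi2 p w2 N).
Proof.
move=> s1 sp wt1 wt2 A12 A22 hS hDL hDM hsize psi10 psi20 hpsi lN hB.
have p0 : (0 < p)%R by lra.
have pi0 : (0 <= p^-1)%R by rewrite invr_ge0 ltW.
have q1 : (1 <= p / s)%R by rewrite ler_pdivlMr ?mul1r//; lra.
have [K K0 hK] :=
  sublinear_local_estimate s1 sp wt1 wt2 A12 A22 hS hDL hsize lN hB.
have [Kd Kd0 hKd] := Ap_doubling q1 wt2 A22.
have [N0 Nnull _] := lN.
move: hpsi; rewrite /psi_condition; set Psi := ereal_sup _ => Psioo.
pose Phi a t := ereal_inf [set (psi1 a l)%:E * wmeas w1 (eball a l) `^ p^-1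
                          | l in `[t, +oo[].
pose W a t := wmeas w2 (eball a t) `^ p^-1.
pose G a r := \int[lebesgue_measure]_(t in `]r, +oo[)
  (Phi a t / W a t * (t^-1)%:E).
have hPsi a r : (0 < r)%R -> ((psi2 a r)^-1)%:E * G a r <= Psi.
  by move=> r0; apply: ereal_sup_ubound; exists (a, r).
(* Turn the finite supremum Psi into a positive real constant. *)
have [P P0 hP] : exists2 P : R, (0 < P)%R & forall a r, (0 < r)%R ->
    ((psi2 a r)^-1)%:E * G a r <= P%:E.
  exists (Num.max 1 (fine Psi))%R; first by rewrite lt_max ltr01.
  move=> a r r0; apply: (le_trans (hPsi a r r0)).
  move: Psioo; case: (Psi) => [x| |]//= _; rewrite ?leNye//.
  by rewrite lee_fin le_max lexx orbT.
pose Kw := (Kd `^ p^-1)%R.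
have Kw0 : (0 < Kw)%R by exact: powR_gt0.
exists (K * (2 * Kw) * P)%R; first by rewrite !mulr_gt0.
move=> f [mf Moo]; have Df : D f by exact: hDM.
have M0 : 0 <= morrey_norm psi1 p w1 f.
  by apply: gen_morrey_norm_ge0 => // E h; exact: poweR_ge0.
suff est : gen_morrey_norm psi2 p w2 N (S f) <=
    (K * (2 * Kw) * P)%:E * morrey_norm psi1 p w1 f.
  split=> //; split; first exact: (sublinear_meas hS Df).
  apply: (le_lt_trans est).
  by rewrite lte_mul_pinfty// lee_fin !mulr_ge0// ltW.
apply: ge_ereal_sup => _ [[a r] /= r0 <-].
have KM : 0 <= (K * (2 * Kw) * P)%:E * morrey_norm psi1 p w1 f.
  by apply: mule_ge0 => //; rewrite lee_fin; apply/ltW; rewrite !mulr_gt0.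
have [w20|w2n0] := eqVneq (wmeas w2 (eball a r)) 0.
  have mSf := sublinear_meas hS Df.
  by rewrite (Nnull _ _ (measurable_eball a r) mSf w20) mule0.
have psi2r : (0 < psi2 a r)%R by exact: psi20.
have Lfin : Lp_norm p w1 (eball a (2 * r)) f < +oo.
  have r20 : (0 < 2 * r)%R by rewrite mulr_gt0.
  apply: (le_lt_trans (Lp_norm_le_morrey a p0 wt1 psi10 mf r20)).
  apply: lte_mul_pinfty => //; first by rewrite ge0_fin_numE.
  apply: lte_mul_pinfty => //; first by rewrite lee_fin ltW// psi10.
  by apply: poweR_lty; exact: wmeas_eball_lty.
have NK := hK f a r Df r0 Lfin.
have [c c0 cE] := wmeas_poweR_fin p^-1 wt2 (lexx r) w2n0.
have sumle : dyadic_sum p w1 w2 f a r <=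
    morrey_norm psi1 p w1 f * ((2 * Kw)%:E * G a r).
  have rho0 k : (0 < 2 ^+ k * r)%R by rewrite mulr_gt0// exprn_gt0.
  have Phi0 t : (0 < t)%R -> 0 <= Phi a t.
    move=> t0; apply: le_ereal_inf_tmp => _ [l /= + <-].
    rewrite in_itv/= andbT => tl; apply: mule_ge0; last exact: poweR_ge0.
    by rewrite lee_fin ltW// psi10// (lt_le_trans t0).
  have Wi0 t : 0 <= (W a t)^-1 by rewrite inve_ge0; exact: poweR_ge0.
  apply: (@le_trans _ _ (morrey_norm psi1 p w1 f *
     \sum_(0 <= k <oo) (Phi a (2 ^+ k * r)%R / W a (2 ^+ k * r)%R))).
    have Mfin : morrey_norm psi1 p w1 f \is a fin_num by rewrite ge0_fin_numE.
    rewrite -(fineK Mfin) -nneseriesZl; last first.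
      by move=> k _; apply: mule_ge0; [exact: Phi0|exact: Wi0].
    apply: lee_nneseries => [k _ _|k _].
      by apply: mule_ge0; [exact: poweR_ge0|exact: Wi0].
    rewrite muleA (fineK Mfin); apply: lee_wpmul2r; first exact: Wi0.
    exact: Lp_norm_le_inf_morrey.
  apply: lee_wpmul2l => //; apply: dyadic_sum_le_integral => //.
  - by move=> t rt; apply: Phi0; exact: lt_le_trans rt.
  - move=> t t' _ tt'; apply: ereal_inf_le_tmp => _ [l /= + <-].
    rewrite in_itv/= andbT => tl; exists l => //.
    by rewrite /= in_itv/= andbT (le_trans tt').
  - move=> t rt; rewrite /W; have [d d0 ->] := wmeas_poweR_fin p^-1 wt2 rt w2n0.
    by rewrite lte_fin d0 ltry.
  move=> t t' rt tt' t'2; rewrite /W /Kw -poweR_EFin.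
  rewrite -(poweRM _ _ (wmeas_ge0 _ wt2)); last by rewrite lee_fin ltW.
  apply: (ge0_le_poweR pi0 (wmeas_ge0 _ wt2)).
  apply: (@le_trans _ _ (wmeas w2 (eball a (2 * t)))).
    exact/le_wmeas/subset_eball.
  by apply: hKd; exact: lt_le_trans rt.
have Sdle : (c^-1)%:E * N (eball a r) (S f) <=
    K%:E * (morrey_norm psi1 p w1 f * ((2 * Kw)%:E * G a r)).
  apply: (@le_trans _ _ (K%:E * dyadic_sum p w1 w2 f a r)).
    rewrite muleC lee_pdivrMr// (le_trans NK)// cE.
    by rewrite [X in _ * X <= _]muleC muleA.
  by apply: lee_wpmul2l sumle; rewrite lee_fin ltW.
have psiV0 : 0 <= ((psi2 a r)^-1)%:E by rewrite lee_fin invr_ge0 ltW.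
rewrite cE inver gt_eqF// -muleA.
apply: (le_trans (lee_wpmul2l psiV0 Sdle)).
have -> : ((psi2 a r)^-1)%:E *
    (K%:E * (morrey_norm psi1 p w1 f * ((2 * Kw)%:E * G a r))) =
    (K * (2 * Kw))%:E * morrey_norm psi1 p w1 f *
    (((psi2 a r)^-1)%:E * G a r).
  rewrite [in RHS](EFinM K) muleCA -!muleA; congr (_ * _).
  by rewrite [LHS]muleCA [RHS]muleCA; congr (_ * _); exact: muleCA.
rewrite [in leRHS](EFinM (K * _)) [leRHS]muleAC.
apply: lee_wpmul2l (hP a r r0).
by apply: mule_ge0 => //; rewrite lee_fin; apply/ltW; rewrite !mulr_gt0.
Qed.

(** * Mixed spaces *)

(** For almost every t the slice of f belongs to the first space, and then the
    norms of the slices of f and of its image compare with the constant C; the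
    integrals of their p0-th powers compare with C^p0. *)
Lemma bounded_op_slices (psi : V -> R -> R) (p0 : R) (w : V -> R) (T : R)
    (S : (V -> R) -> V -> R) (NX NY : (V -> R) -> \bar R) :
  positive_on psi -> (0 < p0)%R -> (forall f, 0 <= NX f) ->
  (forall f, 0 <= NY f) ->
  bounded_op S NX NY -> bounded_op_mixed psi p0 w T S NX NY.
Proof.
move=> psi0 p00 NX0 NY0 [C C0 hB]; exists C => // f [fX foo].
have piv : (0 <= p0^-1)%R by rewrite invr_ge0 ltW.
suff est : mixed_norm psi p0 w T NY (act_slices S f) <=
    C%:E * mixed_norm psi p0 w T NX f.
  split=> //; split.
    by apply: ae_imply fX => t ft tT; have [] := hB _ (ft tT).
  apply: (le_lt_trans est); move: foo; case: mixed_norm => [x _| |_]//.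
    by rewrite -EFinM ltry.
  by rewrite gt0_muleNy ?lte_fin.
apply: ge_ereal_sup => _ [[[a r] t0] /= [r0 t0T] <-].
set B := wmeas w (eball a r) `^ p0^-1.
set J := `]0%R, T[ `&` _.
have k0 : 0 <= ((psi a r)^-1)%:E * B^-1.
  apply: mule_ge0; first by rewrite lee_fin invr_ge0 ltW// psi0.
  by rewrite inve_ge0; exact: poweR_ge0.
have IJ : \int[lebesgue_measure]_(t in J) (NY (act_slices S f ^~ t) `^ p0) <=
    (C `^ p0)%:E * \int[lebesgue_measure]_(t in J) (NX (f ^~ t) `^ p0).
  apply: ae_le_integral_scale.
  - exact: powR_gt0.
  - by move=> t _; exact: poweR_ge0.
  - by move=> t _; exact: poweR_ge0.
  apply: ae_imply fX => t ft [/= tT _].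
  have {}tT : (0 < t < T)%R by move: tT; rewrite in_itv.
  have [_ Sft] := hB _ (ft tT).
  rewrite -poweR_EFin -poweRM// ?lee_fin ?(ltW C0)//.
  by apply: ge0_le_poweR => //; exact: ltW.
apply: (@le_trans _ _ (((psi a r)^-1)%:E * B^-1 * (C%:E *
    (\int[lebesgue_measure]_(t in J) (NX (f ^~ t) `^ p0)) `^ p0^-1))).
  apply: lee_wpmul2l => //.
  have -> : C%:E = (C `^ p0)%:E `^ p0^-1.
    by rewrite poweR_EFin -powRrM divff ?gt_eqF// powRr1// ltW.
  rewrite -poweRM; last 2 first.
  - by rewrite lee_fin powR_ge0.
  - by apply: integral_ge0 => t _; exact: poweR_ge0.
  apply: ge0_le_poweR => //.
  by apply: integral_ge0 => t _; exact: poweR_ge0.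
rewrite muleCA; apply: lee_wpmul2l; first by rewrite lee_fin ltW.
by apply: ereal_sup_ubound; exists (a, r, t0).
Qed.

End weighted_estimates.

Local Close Scope ereal_scope.

Theorem theorem1p10 (R : realType) (m : nat) (T : R) (psi : Rn R m -> R -> R)
    (w : Rn R m -> R) (p0 p s : R) (w1 w2 : Rn R m -> R)
    (D : set (Rn R m -> R)) (S : (Rn R m -> R) -> Rn R m -> R)
    (psi1 psi2 : Rn R m -> R -> R)
    (hT : 0 < T)
    (hpsi : positive_on psi)
    (hw : weight w)
    (hp0 : 1 <= p0)
    (hp : 1 <= p)
    (hs_gt1 : 1 < p -> 1 <= s < p)
    (hs_eq1 : p = 1 -> s = 1)
    (hw1 : weight w1)
    (hw2 : weight w2)
    (hw12 : Ap_class (p / s) (fun x => w1 x `^ s) (fun x => w2 x `^ s))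
    (hw22 : Ap_class (p / s) (fun x => w2 x `^ s) (fun x => w2 x `^ s))
    (hS : sublinear_op D S)
    (hDL : finite_norm_space (Lp_norm p w1 setT) `<=` D)
    (hDM : finite_norm_space (morrey_norm psi1 p w1) `<=` D)
    (hsize : size_condition s D S)
    (hpsi1 : positive_on psi1)
    (hpsi2 : positive_on psi2)
    (hpsi12 : psi_condition p w1 w2 psi1 psi2) :
  (1 < p ->
   bounded_op S (Lp_norm p w1 setT) (Lp_norm p w2 setT) ->
   bounded_op_mixed psi p0 w T S
     (morrey_norm psi1 p w1) (morrey_norm psi2 p w2))
  /\
  (p = 1 ->
   bounded_op S (Lp_norm 1 w1 setT) (weak_Lp_norm 1 w2 setT) ->
   bounded_op_mixed psi p0 w T S
     (morrey_norm psi1 1 w1) (weak_morrey_norm psi2 1 w2)).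
Proof.
have p00 : 0 < p0 by rewrite (lt_le_trans ltr01).
have [s1 sp] : 1 <= s /\ s <= p.
  move: hp; rewrite le_eqVlt => /orP[/eqP p1|/hs_gt1/andP[? /ltW]//].
  by rewrite (hs_eq1 (esym p1)) -p1.
have [A12 A22] : Ap_class (p / s) w1 w2 /\ Ap_class (p / s) w2 w2.
  have [p1|p1] := ltP 1 p.
    have /andP[_ sp'] := hs_gt1 p1.
    have q1 : 1 < p / s by rewrite ltr_pdivlMr ?mul1r// (lt_le_trans ltr01).
    by split; apply: (Ap_class_of_powR q1 s1).
  (* For p = 1 also s = 1, and the weights are their own s-th powers. *)
  have sE : s = 1 by apply: hs_eq1; apply/eqP; rewrite eq_le p1.
  have pow1 (v : Rn R m -> R) : weight v -> (fun x => v x `^ s) = v.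
    by move=> [_ v0 _ _]; apply/funext => x; rewrite sE powRr1.
  by move: hw12 hw22; rewrite !pow1.
split=> [_|p1] hB.
  apply: bounded_op_slices => //.
  - by move=> f; apply: gen_morrey_norm_ge0 => // E h; exact: poweR_ge0.
  - by move=> f; apply: gen_morrey_norm_ge0 => // E h; exact: poweR_ge0.
  exact: (bounded_on_morrey s1 sp hw1 hw2 A12 A22 hS hDL hDM hsize hpsi1 hpsi2
    hpsi12 (Lp_local_norm hp hw2) hB).
have lN := weak_Lp_local_norm hp hw2; have [lN0 _ _] := lN.
rewrite -p1 in hB *; apply: bounded_op_slices => //.
- by move=> f; apply: gen_morrey_norm_ge0 => // E h; exact: poweR_ge0.
- by move=> f; apply: gen_morrey_norm_ge0.
exact: (bounded_on_morrey s1 sp hw1 hw2 A12 A22 hS hDL hDM hsize hpsi1 hpsi2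
  hpsi12 lN hB).
Qed.
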